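(* Let $\mathcal{A}=\langle Q,q_0,\delta,\omega\rangle$ be a non-alternating AAPTA (nAAPTA) over a finite alphabet $\Sigma$. Checking whether $\mathcal{L}(\mathcal{A})=\emptyset$ can be performed in time $O\big((|Q|\cdot(1+|\delta|_B\cdot|\Sigma|))^{|\omega|}\big)$.
   Context: Multisets: a multiset over $S$ is a map $\mu:S\to\mathbb{N}$; $\mu\sqsubseteq\mu'$ pointwise; $(\mu\ominus\mu')(s)=\max(0,\mu(s)-\mu'(s))$; $\mathrm{supp}(\mu)=\{s:\mu(s)>0\}$. An EU-pair over $S$ is $\langle E;U\rangle$, $E$ a finite multiset over $S$, $U\subseteq S$; $\mu$ satisfies it if $E\sqsubseteq\mu$ and $\mathrm{supp}(\mu\ominus E)\subseteq U$. EU-constraints are positive boolean formulas over EU-pairs (with $\top,\bot$). Markings: a marking of $S'$ by $S$ is a map $\nu:S'\to 2^S$; a unitary submarking is $\nu':S'\to S$ with $\nu'(s')\in\nu(s')$; image multiset $s\mapsto|\{s':\nu'(s')=s\}|$. $\nu$ satisfies $\langle E;U\rangle$ if some unitary submarking's image multiset satisfies it; extended to EU-constraints with $\wedge,\vee$ as usual. Trees: a $D$-tree ($D$ finite) is a prefix-closed $t\subseteq D^*$ with root $\varepsilon$; branches are maximal root-paths; a $\Sigma$-labelled tree is $(t,l)$ with $t$ a $D$-tree for some finite $D$ and $l:t\to\Sigma$. Automata: an AAPTA over $\Sigma$ is $\langle Q,q_0,\delta,\omega\rangle$, $\delta:Q\times\Sigma\to$ EU-constraints over $Q$, $\omega:Q\to\mathbb{N}$;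 it is non-alternating if each $\delta(q,\sigma)$ is a disjunction of EU-pairs (or $\top$/$\bot$). An execution tree over $(t,l)$ is a $(D\times Q)$-tree whose node $(d_1,q_1)\cdots(d_k,q_k)$ is labelled $(d_1\cdots d_k,q_k)$, root labelled $(\varepsilon,q_0)$, such that for each node $x$ labelled $(m,q)$ the marking $\nu_x(m\cdot d)=\{q':x\cdot(d,q')\text{ is a node}\}$ of the successors of $m$ satisfies $\delta(q,l(m))$; it is accepting if on every infinite branch the least priority seen infinitely often is even. $\mathcal{L}(\mathcal{A})$ is the set of $\Sigma$-labelled trees with an accepting execution tree. $|\delta|_B$ is the maximum size of the boolean formulas $\delta(q,\sigma)$ and $|\omega|$ is the number of distinct priorities. *)

(* Defs.v *)
(* MathComp world. *)
From HB Require Import structures.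
From mathcomp Require Import all_boot.

Set Implicit Arguments.
Unset Strict Implicit.
Unset Printing Implicit Defensive.

(** * Multisets, EU-pairs, EU-constraints, markings *)

Definition multiset (S : finType) : Type := {ffun S -> nat}.

Definition msub (S : finType) (mu mu' : multiset S) : Prop :=
  forall s, mu s <= mu' s.

(* Truncated subtraction of [nat] is exactly max(0, _ - _). *)
Definition mdiff (S : finType) (mu mu' : multiset S) : multiset S :=
  [ffun s => mu s - mu' s].

Definition msupp (S : finType) (mu : multiset S) : {set S} :=
  [set s | 0 < mu s].

Record eu_pair (S : finType) := EUPair {
  eu_E : multiset S;
  eu_U : {set S}
}.

Definition eu_pair_sat (S : finType) (mu : multiset S) (p : eu_pair S) : Prop :=
  msub (eu_E p) mu /\ msupp (mdiff mu (eu_E p)) \subset eu_U p.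

Inductive eu_constr (S : finType) :=
| EUtop
| EUbot
| EUatom of eu_pair S
| EUand of eu_constr S & eu_constr S
| EUor of eu_constr S & eu_constr S.

Arguments EUtop {S}.
Arguments EUbot {S}.

Definition marking (S' S : finType) : Type := S' -> {set S}.

Definition unitary_submarking (S' S : finType)
    (nu : marking S' S) (u : S' -> S) : Prop :=
  forall s', u s' \in nu s'.

Definition image_multiset (S' S : finType) (u : S' -> S) : multiset S :=
  [ffun s => #|[set s' | u s' == s]|].

Fixpoint marking_sat (S' S : finType) (nu : marking S' S)
    (phi : eu_constr S) : Prop :=
  match phi with
  | EUtop => True
  | EUbot => False
  | EUatom p => exists u : S' -> S,
      unitary_submarking nu u /\ eu_pair_sat (image_multiset u) p
  | EUand phi1 phi2 => marking_sat nu phi1 /\ marking_sat nu phi2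
  | EUor phi1 phi2 => marking_sat nu phi1 \/ marking_sat nu phi2
  end.

(* Size of a written-out formula. The atom <E;U> is written by listing the
   elements of supp(E) (with multiplicities, each taking one machine word in
   the cost model below) and those of U. *)
Fixpoint eu_size (S : finType) (phi : eu_constr S) : nat :=
  match phi with
  | EUtop | EUbot => 1
  | EUatom p => 1 + #|msupp (eu_E p)| + #|eu_U p|
  | EUand phi1 phi2 | EUor phi1 phi2 => 1 + eu_size phi1 + eu_size phi2
  end.

(** * Labelled trees *)

Definition is_tree (D : finType) (t : pred (seq D)) : Prop :=
  t [::] /\ forall m m', t (m ++ m') -> t m.

(* The labelling is a total function on words; only its values on the nodes of
   the tree are ever used. *)
Record ltree (Sigma : finType) := LTree {
  ltree_dir : finType;
  ltree_node : pred (seq ltree_dir);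
  ltree_lab : seq ltree_dir -> Sigma;
  ltree_is_tree : is_tree ltree_node
}.

(** * Automata *)

Record aapta (Q Sigma : finType) := AAPTA {
  init_state : Q;
  delta : Q -> Sigma -> eu_constr Q;
  omega : Q -> nat
}.

Fixpoint pair_disjunction (S : finType) (phi : eu_constr S) : bool :=
  match phi with
  | EUatom _ => true
  | EUor phi1 phi2 => pair_disjunction phi1 && pair_disjunction phi2
  | _ => false
  end.

Definition nonalternating_constr (S : finType) (phi : eu_constr S) : bool :=
  match phi with
  | EUtop | EUbot => true
  | _ => pair_disjunction phi
  end.

Definition nonalternating (Q Sigma : finType) (A : aapta Q Sigma) : Prop :=
  forall q sigma, nonalternating_constr (delta A q sigma).

Section Executions.
Variables (Q Sigma : finType) (A : aapta Q Sigma) (T : ltree Sigma).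
Local Notation D := (ltree_dir T).

(* The node x = (d_1,q_1)...(d_k,q_k) carries the label
   (node_pos x, node_state x) = (d_1...d_k, q_k), and (epsilon, q_0) if k = 0. *)
Definition node_pos (x : seq (D * Q)) : seq D := unzip1 x.
Definition node_state (x : seq (D * Q)) : Q := last (init_state A) (unzip2 x).

(* The successors of m are represented by the directions leading to them. *)
Definition successors (m : seq D) : finType :=
  {d : D | ltree_node (rcons m d)}.

Definition exec_marking (X : pred (seq (D * Q))) (x : seq (D * Q)) :
    marking (successors (node_pos x)) Q :=
  fun d => [set q' | X (rcons x (val d, q'))].

Definition execution_tree (X : pred (seq (D * Q))) : Prop :=
  [/\ is_tree X,
      forall x, X x -> ltree_node (node_pos x)
    & forall x, X x ->
        marking_sat (@exec_marking X x)
          (delta A (node_state x) (ltree_lab (node_pos x)))].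

Definition seen_infinitely_often (b : nat -> D * Q) (p : nat) : Prop :=
  forall n, exists2 k, n <= k & omega A (node_state (mkseq b k)) = p.

Definition accepting (X : pred (seq (D * Q))) : Prop :=
  forall b : nat -> D * Q, (forall n, X (mkseq b n)) ->
    exists p, [/\ seen_infinitely_often b p,
                  forall p', seen_infinitely_often b p' -> p <= p'
                & ~~ odd p].

End Executions.

Definition language (Q Sigma : finType) (A : aapta Q Sigma)
    (T : ltree Sigma) : Prop :=
  exists X : pred (seq (ltree_dir T * Q)),
    execution_tree A X /\ accepting A X.

Definition language_empty (Q Sigma : finType) (A : aapta Q Sigma) : Prop :=
  forall T : ltree Sigma, ~ language A T.

Definition delta_size (Q Sigma : finType) (A : aapta Q Sigma) : nat :=
  \max_(q : Q) \max_(sigma : Sigma) eu_size (delta A q sigma).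

Definition num_priorities (Q Sigma : finType) (A : aapta Q Sigma) : nat :=
  size (undup (codom (omega A))).

(** * Uniform-cost random access machine

    A RAM in structured form: a program uses finitely many registers and an
    unbounded memory with indirect addressing, both holding natural numbers.
    The arithmetic primitives are addition, truncated subtraction and halving
    (right shift by one). There is no multiplication, so that a run of n steps
    can only produce numbers of n more bits than the constants and inputs.
    Every primitive operation, memory access, assignment and test costs 1. *)

Inductive expr :=
| Const of nat
| Reg of nat
| Add of expr & expr
| Sub of expr & expr
| Half of expr
| Fetch of expr.

Inductive cmd :=
| Assign of nat & expr
| Store of expr & expr
| Seq of cmd & cmd
| If of expr & cmd & cmd
| While of expr & cmd.

Record ram_state := RamState {
  regs : nat -> nat;
  mem : nat -> nat
}.

Definition upd (f : nat -> nat) (i v : nat) : nat -> nat :=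
  fun j => if j == i then v else f j.

Fixpoint eval (s : ram_state) (e : expr) : nat :=
  match e with
  | Const n => n
  | Reg i => regs s i
  | Add e1 e2 => eval s e1 + eval s e2
  | Sub e1 e2 => eval s e1 - eval s e2
  | Half e1 => (eval s e1)./2
  | Fetch e1 => mem s (eval s e1)
  end.

Fixpoint expr_cost (e : expr) : nat :=
  match e with
  | Const _ | Reg _ => 1
  | Add e1 e2 | Sub e1 e2 => 1 + expr_cost e1 + expr_cost e2
  | Half e1 | Fetch e1 => 1 + expr_cost e1
  end.

(* [exec c s n s']: started in s, the command c halts in s' after n steps.
   Tests succeed on nonzero values. *)
Inductive exec : cmd -> ram_state -> nat -> ram_state -> Prop :=
| ExecAssign i e s :
    exec (Assign i e) s (1 + expr_cost e)
      (RamState (upd (regs s) i (eval s e)) (mem s))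
| ExecStore a e s :
    exec (Store a e) s (1 + expr_cost a + expr_cost e)
      (RamState (regs s) (upd (mem s) (eval s a) (eval s e)))
| ExecSeq c1 c2 s1 s2 s3 n1 n2 :
    exec c1 s1 n1 s2 -> exec c2 s2 n2 s3 -> exec (Seq c1 c2) s1 (n1 + n2) s3
| ExecIfTrue e c1 c2 s s' n :
    eval s e != 0 -> exec c1 s n s' ->
    exec (If e c1 c2) s (1 + expr_cost e + n) s'
| ExecIfFalse e c1 c2 s s' n :
    eval s e = 0 -> exec c2 s n s' ->
    exec (If e c1 c2) s (1 + expr_cost e + n) s'
| ExecWhileTrue e c s1 s2 s3 n1 n2 :
    eval s1 e != 0 -> exec c s1 n1 s2 -> exec (While e c) s2 n2 s3 ->
    exec (While e c) s1 (1 + expr_cost e + n1 + n2) s3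
| ExecWhileFalse e c s :
    eval s e = 0 -> exec (While e c) s (1 + expr_cost e) s.

(* The input word sits at the beginning of the memory; everything else is 0. *)
Definition ram_init (inp : seq nat) : ram_state :=
  RamState (fun _ => 0) (fun i => nth 0 inp i).

(* The answer is read off register 0: 1 for yes, 0 for no. *)
Definition ram_answers_within (c : cmd) (inp : seq nat) (n : nat) (P : Prop) :
    Prop :=
  exists (b : bool) (k : nat) (s : ram_state),
    [/\ exec c (ram_init inp) k s, k <= n, regs s 0 = b & b <-> P].

(** * Encoding of automata as RAM inputs *)

Definition code_state (S : finType) (s : S) : nat := enum_rank s.

(* Polish notation; multiplicities are given only on the support of E. *)
Fixpoint code_constr (S : finType) (phi : eu_constr S) : seq nat :=
  match phi with
  | EUtop => [:: 0]
  | EUbot => [:: 1]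
  | EUand phi1 phi2 => 2 :: code_constr phi1 ++ code_constr phi2
  | EUor phi1 phi2 => 3 :: code_constr phi1 ++ code_constr phi2
  | EUatom p =>
      [:: 4, #|msupp (eu_E p)| &
        flatten [seq [:: code_state s; eu_E p s] | s <- enum (msupp (eu_E p))]]
      ++ #|eu_U p| :: [seq code_state s | s <- enum (eu_U p)]
  end.

Definition code_aapta (Q Sigma : finType) (A : aapta Q Sigma) : seq nat :=
  [:: #|Q|, #|Sigma|, code_state (init_state A) &
    [seq omega A q | q <- enum Q] ++
    flatten [seq code_constr (delta A q sigma)
            | q <- enum Q, sigma <- enum Sigma]].

(* Main.v *)
Require Import Defs.
From mathcomp Require Import all_boot zify.
From Stdlib Require Import Classical.

(** Satisfying an EU-pair <E;U> is easiest when exactly the states of E are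
    spawned, so emptiness is a parity game on Q: the automaton picks a letter
    and a disjunct <E;U>, the opponent picks a state of supp(E), and the least
    priority seen infinitely often must be even. The winning region is a
    fixpoint nested over the priorities. A least fixpoint only grows, so a rank
    (the stage at which a state enters) yields a positional strategy; dualising
    gives the opponent's one.

    The fixpoint of the largest priority is computed in one go: a round
    saturates a worklist with counters, as for Horn clauses, in time linear in
    the input. The other levels are driven like an odometer: commit the deepest
    level at which the last round disagrees with the current assignment and
    reset the deeper ones. A level with m states changes at most m times
    between two resets, so there are at most the product of the m + 1 rounds;
    as every such m is less than |Q|, this is at most |Q| ^ (|omega| - 1). *)

Set Implicit Arguments.
Unset Strict Implicit.
Unset Printing Implicit Defensive.

(** * Nested fixpoints and positional strategies *)

Section NestedFixpoints.
Variables (Q : finType) (om : Q -> nat).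
Implicit Types (F E : {set Q} -> {set Q}) (mu : nat -> bool) (X Y Z : {set Q}).

(** The program is fixed while the number of priorities varies, so the nesting cannot be written as
    nested loops; the odometer replaces it by a single loop whose whole state is one bit per state
    of [Q]. Priorities may also be arbitrarily large, and only how many of them occur may enter the
    bound: no loop ranges over priority values, and a level without states contributes a factor 1.
    Multiplicities are unbounded too, but the game sees only supp(E); they come back when a winning
    strategy is unfolded into a tree, whose directions number the required copies of each state. The
    remaining factor of the bound is the length of the input. The fixpoint results allow an
    arbitrary monotone operator and an arbitrary choice of least levels, since they are applied to
    both players and, in the algorithm, to whichever side makes the level of the largest priority a
    least one. *)

Definition with_level (k : nat) X Y : {set Q} :=
  [set q | if om q == k then q \in X else q \in Y].

(* Levels k, ..., k + j - 1, outermost first. The iteration starts from Y itself,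
   which must therefore be default (see [is_default]) at these levels. *)
Fixpoint nested_fix F (j k : nat) Y : {set Q} :=
  if j is j'.+1 then
    let E := nested_fix F j' k.+1 in E (iter #|Q| (fun Z => with_level k (E Z) Y) Y)
  else F Y.

Definition mono F := forall Y Z, Y \subset Z -> F Y \subset F Z.
Definition dual F Y : {set Q} := ~: F (~: Y).
(* [mu p] says that the fixpoint of level p is a least one. *)
Definition is_default mu (k : nat) Y := forall q, k <= om q -> (q \in Y) = ~~ mu (om q).

Lemma with_level_subset k X X' Y Y' :
  X \subset X' -> Y \subset Y' -> with_level k X Y \subset with_level k X' Y'.
Proof.
move=> /subsetP sX /subsetP sY; apply/subsetP=> q; rewrite !inE.
by case: ifP => _; [apply: sX | apply: sY].
Qed.

Lemma with_levelC k X Y : ~: with_level k X Y = with_level k (~: X) (~: Y).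
Proof. by apply/setP=> q; rewrite !inE; case: ifP. Qed.

Lemma nested_fix_mono F j k : mono F -> mono (nested_fix F j k).
Proof.
move=> mF; elim: j k => [|j IH] k //= Y Z sYZ; apply: (IH).
by elim: #|Q| => //= i IHi; apply: with_level_subset => //; apply: IH.
Qed.

Lemma dual_mono F : mono F -> mono (dual F).
Proof. by move=> mF Y Z sYZ; rewrite setCS; apply: mF; rewrite setCS. Qed.

(** Complementation commutes with [with_level], hence with every stage of the iteration. This is the
    source of determinacy: outside a nested fixpoint of [F] lies one of [dual F], to which
    [strategy_exists] applies as well. *)
Lemma nested_fix_dual F j k Y : nested_fix (dual F) j k (~: Y) = ~: nested_fix F j k Y.
Proof.
elim: j k Y => [|j IH] k Y /=; first by rewrite /dual setCK.
rewrite -IH; congr (nested_fix _ _ _ _).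
by elim: #|Q| => //= i ->; rewrite with_levelC IH.
Qed.

Lemma eq_nested_fix E1 E2 n k Y : E1 =1 E2 ->
  E1 (iter n (fun Z => with_level k (E1 Z) Y) Y) = E2 (iter n (fun Z => with_level k (E2 Z) Y) Y).
Proof. by move=> eE; rewrite eE; congr E2; elim: n => //= i ->; rewrite eE. Qed.

(** The innermost level can be absorbed into the operator. The algorithm computes that level in one
    saturation, so its odometer runs on the other levels only. *)
Lemma nested_fix_last F j k Y : nested_fix F j.+1 k Y = nested_fix (nested_fix F 1 (k + j)) j k Y.
Proof.
elim: j k Y => [|j IH] k Y; first by rewrite addn0.
by apply: (eq_nested_fix (E1 := nested_fix F j.+1 k.+1)) => Z; rewrite IH addSnnS.
Qed.

Lemma is_defaultW mu k k' Y : k <= k' -> is_default mu k Y -> is_default mu k' Y.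
Proof. by move=> le_kk' dY q le_q; apply: dY; apply: leq_trans le_q. Qed.

Lemma is_default_with_level mu k X Y : is_default mu k Y -> is_default mu k.+1 (with_level k X Y).
Proof.
move=> dY q ltkq; rewrite inE ifN ?neq_ltn ?ltkq ?orbT //.
by apply: dY; apply: ltnW.
Qed.

Lemma is_defaultC mu k Y : is_default mu k Y -> is_default (fun p => ~~ mu p) k (~: Y).
Proof. by move=> dY q lq; rewrite inE dY. Qed.

(** * Iteration of a single level *)

Section Iteration.
Variables (E : {set Q} -> {set Q}) (mu : nat -> bool) (k : nat) (Y : {set Q}).
Hypotheses (mE : mono E) (dY : is_default mu k Y).

Definition approx (i : nat) : {set Q} := iter i (fun Z => with_level k (E Z) Y) Y.

Lemma approx_low i q : om q != k -> (q \in approx i) = (q \in Y).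
Proof. by move=> /negbTE neq; case: i => [|i] //=; rewrite inE neq. Qed.

Lemma approxS i q : om q = k -> (q \in approx i.+1) = (q \in E (approx i)).
Proof. by move=> e; rewrite /= inE e eqxx. Qed.

Lemma approx0 q : om q = k -> (q \in approx 0) = ~~ mu k.
Proof. by move=> e; rewrite /= dY e. Qed.

Lemma is_default_approx i : is_default mu k.+1 (approx i).
Proof. by case: i => [|i]; [apply: is_defaultW dY | apply: is_default_with_level]. Qed.

Lemma approx_incS i : mu k -> approx i \subset approx i.+1.
Proof.
move=> mk; elim: i => [|i IH]; last by apply: with_level_subset => //; apply: mE.
apply/subsetP=> q; case: (eqVneq (om q) k) => e.
  by rewrite approx0 // mk.
by rewrite !approx_low.
Qed.

Lemma approx_decS i : ~~ mu k -> approx i.+1 \subset approx i.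
Proof.
move=> mk; elim: i => [|i IH]; last by apply: with_level_subset => //; apply: mE.
apply/subsetP=> q; case: (eqVneq (om q) k) => e.
  by rewrite [in X in _ -> X]approx0 // mk.
by rewrite !approx_low.
Qed.

Definition n_changed Z := #|[set q | (om q == k) && ((q \in Z) != ~~ mu k)]|.

(** Stages move monotonically away from the default value, so a state that has left it never
    returns. Two stages can differ only at level [k], so a change adds such a state. *)
Lemma n_changed_lt i : approx i != approx i.+1 -> n_changed (approx i) < n_changed (approx i.+1).
Proof.
have inc q : (q \in approx i) != ~~ mu k -> (q \in approx i.+1) != ~~ mu k.
  have := @approx_incS i; have := @approx_decS i.
  case: (mu k) => [_ /(_ isT) /subsetP/(_ q) h|/(_ isT) /subsetP/(_ q) h _]; move: h;
    by case: (q \in approx i) (q \in approx i.+1) => [] [] // /(_ isT).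
move=> neq.
have [q e neq'] : exists2 q, om q = k & (q \in approx i) != (q \in approx i.+1).
  apply: NNPP => no; move/eqP: neq; apply; apply/setP=> q.
  case: (eqVneq (om q) k) => e; last by rewrite !approx_low.
  by apply/eqP/negPn/negP => ne; apply: no; exists q.
move: (approx i.+1) inc neq' => Z inc neq'.
apply: proper_card; rewrite properE; apply/andP; split.
  by apply/subsetP=> q'; rewrite !in_set => /andP[-> /inc].
apply/negP => /subsetP/(_ q); move: (inc q) neq'; rewrite !in_set e eqxx /=.
by case: (mu k) (q \in approx i) (q \in Z) => [] [] [] // h1 _ h2; 
  first [by move: (h1 isT) | by move: (h2 isT)].
Qed.

(** [n_changed] grows at every unstable stage and is at most the size of level [k]. The bound by
    that size, instead of [#|Q|], is what makes the number of rounds a product over the levels. *)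
Lemma approx_stab : exists J, [/\ J <= #|[set q | om q == k]|,
  forall i, i < J -> approx i != approx i.+1 & approx J = approx J.+1].
Proof.
set nk := #|_|.
have ex : exists i, approx i == approx i.+1.
  apply: NNPP => nex.
  have lb i : i <= n_changed (approx i).
    elim: i => // i IH; apply: leq_ltn_trans IH _; apply: n_changed_lt.
    by apply/negP => e; apply: nex; exists i.
  have := lb nk.+1; rewrite leqNgt ltnS => /negP; apply.
  by apply: subset_leq_card; apply/subsetP=> q; rewrite !inE => /andP[].
case: (ex_minnP ex) => J /eqP eJ minJ; exists J; split=> //.
  have lb i : i <= J -> i <= n_changed (approx i).
    elim: i => // i IH ltiJ; apply: leq_ltn_trans (IH (ltnW ltiJ)) _; apply: n_changed_lt.
    by apply/negP => /minJ; rewrite leqNgt ltiJ.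
  apply: leq_trans (lb J (leqnn _)) _.
  by apply: subset_leq_card; apply/subsetP=> q; rewrite !inE => /andP[].
by move=> i lti; apply/negP=> /minJ; rewrite leqNgt lti.
Qed.

Lemma approx_after J i : approx J = approx J.+1 -> J <= i -> approx i = approx J.
Proof.
move=> eJ /subnKC <-; elim: (i - J) => [|m IH]; first by rewrite addn0.
by rewrite addnS [LHS]/= -/(approx (J + m)) IH -/(approx J.+1).
Qed.

Lemma approx_fix : approx #|Q| = approx #|Q|.+1.
Proof.
case: approx_stab => J [leJ _ eJ].
have leQ : J <= #|Q| by apply: leq_trans leJ (max_card _).
by rewrite !(approx_after eJ) // (leq_trans leQ).
Qed.

Lemma approx_inc i i' : mu k -> i <= i' -> approx i \subset approx i'.
Proof.
move=> mk /subnKC <-; elim: (i' - i) => [|m IH]; first by rewrite addn0.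
by rewrite addnS; apply: subset_trans IH _; apply: approx_incS.
Qed.

End Iteration.

(** * Parity condition and positional strategies *)

Definition inf_often (b : nat -> Q) (p : nat) :=
  forall n, exists2 i, n <= i & om (b i) = p.

(** With [mu := odd] this is the acceptance condition of the automaton; with [mu] negated it is that
    of the opponent. *)
Definition parity_win mu (b : nat -> Q) :=
  exists p, [/\ inf_often b p, forall p', inf_often b p' -> p <= p' & ~~ mu p].

Lemma parity_win_shift mu b n :
  parity_win mu (fun i => b (i + n)) -> parity_win mu b.
Proof.
have io p : inf_often (fun i => b (i + n)) p <-> inf_often b p.
  split=> h m.
    by case: (h m) => i lei e; exists (i + n) => //; apply: leq_trans lei (leq_addr _ _).
  case: (h (m + n)) => i lei e; exists (i - n); first by lia.
  by rewrite subnK //; lia.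
case=> p [/io iop minp mup]; exists p; split=> // p' /io; exact: minp.
Qed.

Lemma nonincreasing_eventually_const (r : nat -> nat) :
  (forall i, r i.+1 <= r i) -> exists n, forall i, n <= i -> r i = r n.
Proof.
move=> dec.
have dec' i j : i <= j -> r j <= r i.
  by move=> /subnKC <-; elim: (j - i) => [|m IH]; rewrite ?addn0 // addnS (leq_trans (dec _)).
suff gen m n : r n <= m -> exists n, forall i, n <= i -> r i = r n by apply: (gen (r 0) 0).
elim: m n => [|m IH] n len.
  by exists n => i lei; have := dec' _ _ lei; lia.
case: (classic (exists2 i, n <= i & r i < r n)) => [[i lei lt]|no].
  by apply: (IH i); lia.
exists n => i lei; have := dec' _ _ lei; rewrite leq_eqVlt => /orP[/eqP //|lt].
by case: no; exists i.
Qed.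

(** A strategy that only concerns the levels from [k] on: a move to a lower level merely has to land
    in [Y], and a play is judged only if it never leaves these levels. Both concessions vanish at
    [k = 0]. *)
Definition winning_strategy F mu j k Y (S : Q -> {set Q}) :=
  (forall q, q \in nested_fix F j k Y -> q \in F (S q) /\
     forall s, s \in S q -> if om s < k then s \in Y else s \in nested_fix F j k Y) /\
  (forall b : nat -> Q, b 0 \in nested_fix F j k Y ->
     (forall i, b i.+1 \in S (b i)) -> (forall i, k <= om (b i)) ->
     parity_win mu b).

(* Greatest level: follow the strategy of the limit. Least level: follow the
   strategy of the first approximant containing the state; its index never
   increases along a play and drops at each visit of level k. *)
Lemma strategy_exists F mu j k Y :
  mono F -> (forall q, om q < k + j) -> is_default mu k Y ->
  exists S, winning_strategy F mu j k Y S.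
Proof.
move=> mF; elim: j k Y => [|j IH] k Y omb dY.
  exists (fun=> Y); split=> [q /= qF|b _ _ kb]; last first.
    by have := omb (b 0); rewrite addn0 ltnNge kb.
  by split=> // s sY; have := omb s; rewrite addn0 => ->.
pose E := nested_fix F j k.+1; have mE : mono E by apply: nested_fix_mono.
pose R i := E (approx E k Y i).
have omb' q : om q < k.+1 + j by rewrite addSnnS.
have evE : nested_fix F j.+1 k Y = R #|Q| by [].
have [S HS] : exists S : 'I_#|Q|.+1 -> Q -> {set Q}, forall i : 'I_#|Q|.+1,
    winning_strategy F mu j k.+1 (approx E k Y i) (S i).
  have ex (i : 'I_#|Q|.+1) : exists S, winning_strategy F mu j k.+1 (approx E k Y i) S.
    by apply: IH => //; apply: is_default_approx.
  exact (fin_all_exists ex).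
case mk: (mu k); last first.
  have {}HS : winning_strategy F mu j k.+1 (approx E k Y #|Q|) (S ord_max) := HS ord_max.
  exists (S ord_max); rewrite /winning_strategy evE.
  case: HS => HS1 HS2; split=> [q qR|b b0 bS kb].
    case: (HS1 q qR) => qF Hs; split=> // s sS; have := Hs s sS.
    case: (ltngtP (om s) k) => [lt|gt|eq].
    - by rewrite leqW // approx_low // neq_ltn lt.
    - by rewrite ltnS leqNgt gt.
    - by rewrite eq ltnSn {1}(approx_fix mE dY) approxS.
  (* No level below [k] occurs, so if [k] recurs it is the least recurring one and has the good
     parity; otherwise a suffix avoids it and the strategy for the inner levels wins there. *)
  case: (classic (inf_often b k)) => [iok|/not_all_ex_not[n nk]].
    exists k; split=> //; last by rewrite mk.
    by move=> p' /(_ 0)[i _ <-].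
  apply: (@parity_win_shift _ _ n); apply: HS2 => [|i|i]; rewrite ?addSn //.
    rewrite add0n; elim: n {nk} => // n bn.
    case: (HS1 _ bn) => _ /(_ _ (bS n)); case: ifP => // lt.
    have e : om (b n.+1) = k by apply/eqP; rewrite eqn_leq kb andbT -ltnS.
    by rewrite {1}(approx_fix mE dY) approxS.
  rewrite ltn_neqAle kb andbT; apply/eqP => e; apply: nk; exists (i + n) => //.
  exact: leq_addl.
pose rk q := find (fun i => q \in R i) (iota 0 #|Q|.+1).
have rkP q : q \in R #|Q| -> rk q < #|Q|.+1 /\ q \in R (rk q).
  move=> qR; have hs : has (fun i => q \in R i) (iota 0 #|Q|.+1).
    by apply/hasP; exists #|Q| => //; rewrite mem_iota /= add0n.
  have lt : rk q < #|Q|.+1 by have := hs; rewrite has_find size_iota.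
  by split=> //; have := nth_find 0 hs; rewrite nth_iota.
have rk_min q i : i <= #|Q| -> q \in R i -> rk q <= i.
  move=> lei qi; rewrite leqNgt; apply/negP => lt; have := before_find 0 lt.
  by rewrite nth_iota ?ltnS // add0n qi.
have R_inc i : i <= #|Q| -> R i \subset R #|Q|.
  by move=> lei; apply: (mE); exact: (approx_inc mE dY mk lei).
pose So q := S (inord (rk q)) q.
have stepS q s : q \in R #|Q| -> s \in So q ->
    [/\ om s < k -> s \in Y, k <= om s -> s \in R #|Q|,
        k <= om s -> rk s <= rk q & om s = k -> rk s < rk q].
  move=> qR sS; have [lt qr] := rkP _ qR.
  have [HS1 _] := HS (inord (rk q)); rewrite inordK // in HS1.
  have [_ /(_ s sS)] := HS1 q qr.
  case: (ltngtP (om s) k) => [lts|gts|eqs].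
  - rewrite leqW // approx_low ?neq_ltn ?lts // => sY.
    have nk : (k <= om s) = false by rewrite leqNgt lts.
    by split; rewrite ?nk // => e; rewrite e ltnn in lts.
  - rewrite ltnS leqNgt gts /= => sR; have le := rk_min s _ lt sR.
    split=> [//|_|//|e]; last by rewrite e ltnn in gts.
    exact: (subsetP (R_inc _ lt)).
  rewrite eqs ltnSn => sa.
  (* Stage 0 contains no state of a least level, so the stage [rk q] containing [s] is positive, and
     [s] lies in [R] of the stage before: the rank drops strictly. *)
  have [i ltir sR] : exists2 i, i < rk q & s \in R i.
    case: (rk q) sa => [|i] sa; last by exists i => //; rewrite -approxS in sa *.
    by move: sa; rewrite (approx0 E dY) // mk.
  have lt' : i <= #|Q| by apply: leq_trans (ltnW ltir) lt.
  have le : rk s < rk q by apply: leq_ltn_trans (rk_min s i lt' sR) ltir.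
  by split=> [|_|_|_] //; [exact: (subsetP (R_inc _ lt')) | exact: ltnW].
exists So; rewrite /winning_strategy evE; split=> [q qR|b b0 bS kb].
  have [lt qr] := rkP _ qR; split.
    by have [HS1 _] := HS (inord (rk q)); rewrite inordK // in HS1; case: (HS1 q qr).
  move=> s /(stepS _ _ qR)[h1 h2 _ _]; case: ifP => [/h1 //|/negbT].
  by rewrite -leqNgt.
have bR i : b i \in R #|Q|.
  by elim: i => // i bi; case: (stepS _ _ bi (bS i)) => _ /(_ (kb _)).
have [n Hn] : exists n, forall i, n <= i -> rk (b i) = rk (b n).
  apply: (@nonincreasing_eventually_const (fun i => rk (b i))) => i.
  by case: (stepS _ _ (bR i) (bS i)) => _ _ /(_ (kb _)).
apply: (@parity_win_shift _ _ n.+1).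
have [lt qr] := rkP _ (bR n.+1).
have rkE i : rk (b (i + n.+1)) = rk (b n.+1) by rewrite (Hn (i + n.+1)) ?(Hn n.+1) // addnS ltnW // ltnS leq_addl.
have [_ HS2] := HS (inord (rk (b n.+1))); rewrite inordK // in HS2.
apply: HS2 => [|i|i]; rewrite ?add0n //.
  by rewrite -(rkE i) addSn; apply: bS.
(* The suffix starts at [n.+1] so that every position has a predecessor whose rank is already the
   final one; a visit of level [k] would lower it. *)
rewrite ltn_neqAle kb andbT; apply/eqP => e.
have [_ _ _] := stepS _ _ (bR (i + n)) (bS (i + n)).
by rewrite -addnS => /(_ (esym e)); rewrite rkE (Hn n.+1) // (Hn (i + n)) ?leq_addl // ltnn.
Qed.

(** * The odometer and its number of rounds *)

Section Machine.
Variables (E : {set Q} -> {set Q}) (mu : nat -> bool) (M : nat).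
Hypothesis mE : mono E.

Definition unstable Y k := exists2 q, om q = k & (q \in E Y) != (q \in Y).
Definition stable k Y := forall q, k <= om q -> om q < M -> (q \in E Y) = (q \in Y).
Definition reset_above k Y : {set Q} :=
  [set q | if om q == k then q \in E Y else
           if om q < k then q \in Y else ~~ mu (om q)].

(* The odometer: commit the deepest unstable level, reset the deeper ones. *)
Inductive reach : nat -> {set Q} -> {set Q} -> Prop :=
| ReachRefl Y : reach 0 Y Y
| ReachStep k t Y Z : k < M -> unstable Y k -> stable k.+1 Y ->
    reach t (reset_above k Y) Z -> reach t.+1 Y Z.

Lemma reach_trans t t' X Y Z : reach t X Y -> reach t' Y Z -> reach (t + t') X Z.
Proof. by elim=> // k t1 X1 Y1 ltk un st _ IH /IH; apply: ReachStep. Qed.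

Definition nclass p := #|[set q | om q == p]|.

(** The odometer replays the nested iteration exactly. Starting from a stage of level [k], the inner
    levels settle at some [Z] with [E Z] equal to the inner fixpoint, and committing level [k] then
    produces the next stage, with the inner levels back at their defaults. There are at most
    [nclass k] commits; each of them, like the end, is preceded by fewer than [T] inner steps. *)
Lemma reach_fixpoint j k Y : k + j = M -> is_default mu k Y ->
  exists t Z, [/\ reach t Y Z, t < \prod_(k <= p < M) (nclass p).+1, stable k Z,
    forall q, om q < k -> (q \in Z) = (q \in Y) & E Z = nested_fix E j k Y].
Proof.
elim: j k Y => [|j IH] k Y.
  rewrite addn0 => -> dY; exists 0, Y; rewrite big_geq //; split=> //; first by constructor.
  by move=> q le lt; have := leq_trans lt le; rewrite ltnn.
rewrite -addSnnS => eM dY; pose E' := nested_fix E j k.+1.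
have mE' : mono E' by apply: nested_fix_mono.
have ltkM : k < M by rewrite -eM addSn ltnS leq_addr.
rewrite big_ltn //; set T := \prod_(_ <= p < M) _.
have dA i := is_default_approx E' dY i.
have [J [leJ neJ eJ]] := approx_stab mE' dY.
have H i : i <= J -> exists2 t, t <= i * T & reach t Y (approx E' k Y i).
  elim: i => [|i IHi] ltiJ; first by exists 0 => //; constructor.
  have [t let1 rt] := IHi (ltnW ltiJ).
  have [t' [Z [rZ ltt' stZ lowZ eZ]]] := IH k.+1 (approx E' k Y i) eM (dA i).
  (* The [t'] inner steps and the commit itself, at most [T] together since [t'] is strictly below
     [T]. *)
  exists (t + t'.+1); first by rewrite mulSn; lia.
  apply: reach_trans rt _; rewrite -addn1; apply: reach_trans rZ _.
  have eE' : E Z = E' (approx E' k Y i) by [].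
  have lowE q : om q = k -> (q \in Z) = (q \in approx E' k Y i).
    by move=> e; apply: lowZ; rewrite e.
  apply: (@ReachStep k) => //.
    apply: NNPP => nun; have /eqP := neJ i ltiJ; apply; apply/setP=> q.
    case: (eqVneq (om q) k) => e; last by rewrite !approx_low.
    rewrite approxS // -eE' -lowE //; apply/eqP; rewrite eq_sym; apply/negPn/negP=> ne.
    by apply: nun; exists q.
  suff -> : reset_above k Z = approx E' k Y i.+1 by constructor.
  apply/setP=> q; rewrite inE /= inE -eE'; case: ifP => // /negbT ne.
  case: ifP => [lt|/negbT nlt].
    by rewrite lowZ ?leqW // approx_low.
  by rewrite dY //; lia.
have [t let1 rt] := H J (leqnn J).
have [t' [Z [rZ ltt' stZ lowZ eZ]]] := IH k.+1 (approx E' k Y J) eM (dA J).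
exists (t + t'), Z; split.
- exact: reach_trans rt rZ.
- have : J * T <= nclass k * T by rewrite leq_mul2r leJ orbT.
  by rewrite mulSn; lia.
- move=> q; rewrite leq_eqVlt => /orP[/eqP e _|lt ltM]; last exact: stZ.
  by rewrite lowZ -?e // eZ -/E' [in RHS]eJ approxS // -e.
- by move=> q lt; rewrite lowZ ?leqW // approx_low // neq_ltn lt.
- rewrite eZ [RHS]/= -/E' -/(approx E' k Y #|Q|) (approx_after eJ) //.
  exact: leq_trans leJ (max_card _).
Qed.

End Machine.

End NestedFixpoints.

(** * Emptiness as a parity game *)

Section Options.
Variable Q : finType.
Implicit Types (phi : eu_constr Q) (Y : {set Q}).

Lemma in_msupp (mu : multiset Q) s : (s \in msupp mu) = (0 < mu s).
Proof. by rewrite inE. Qed.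

(** An option lists the states that the opponent may choose from once a disjunct is taken. [EUtop]
    gives the empty option, which is always enabled; a nonalternating formula has no conjunction,
    hence the empty list there. *)
Fixpoint options phi : seq (seq Q) :=
  match phi with
  | EUtop => [:: [::]]
  | EUbot | EUand _ _ => [::]
  | EUatom p => [:: enum (msupp (eu_E p))]
  | EUor phi1 phi2 => options phi1 ++ options phi2
  end.

Definition enabled Y phi := has (all [in Y]) (options phi).

(** Spawning exactly [E] leaves nothing in the difference, so [U] is respected whatever it is. The
    statement quantifies over all markings because the tree realising the choice is only built
    later. *)
Lemma enabled_realised Y phi : nonalternating_constr phi -> enabled Y phi ->
  exists2 E : multiset Q, msupp E \subset Y &
    forall (S' : finType) (nu : marking S' Q) (u : S' -> Q),
      unitary_submarking nu u -> image_multiset u = E -> marking_sat nu phi.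
Proof.
have atoms psi : pair_disjunction psi -> enabled Y psi ->
  exists2 E : multiset Q, msupp E \subset Y &
    forall (S' : finType) (nu : marking S' Q) (u : S' -> Q),
      unitary_submarking nu u -> image_multiset u = E -> marking_sat nu psi.
  elim: psi => //= [p _|psi1 IH1 psi2 IH2 /andP[pd1 pd2]].
    rewrite /enabled /= orbF => /allP sub; exists (eu_E p).
      by apply/subsetP=> s ss; apply: sub; rewrite mem_enum.
    move=> S' nu u usub e; exists u; split=> //; rewrite /eu_pair_sat e; split.
      by move=> s.
    by apply/subsetP=> s; rewrite in_msupp ffunE subnn.
  rewrite /enabled has_cat => /orP[/(IH1 pd1)|/(IH2 pd2)] [E sE hE];
    exists E => // S' nu u usub e.
    by left; apply: hE e.
  by right; apply: hE e.
case: phi => //=; first last.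
- by move=> phi1 phi2; apply: (atoms (EUor phi1 phi2)).
- by move=> p; apply: (atoms (EUatom p)).
move=> _ _; exists [ffun=> 0] => //.
by apply/subsetP=> s; rewrite in_msupp ffunE.
Qed.

(** As [E] is below the image multiset, every state of its support is the value of some successor
    under the submarking, hence occurs in the marking. *)
Lemma marking_sat_enabled (S' : finType) (nu : marking S' Q) phi :
  nonalternating_constr phi -> marking_sat nu phi ->
  enabled [set q | [exists s', q \in nu s']] phi.
Proof.
have atoms psi : pair_disjunction psi -> marking_sat nu psi ->
    enabled [set q | [exists s', q \in nu s']] psi.
  elim: psi => //= [p _ [u [usub [sE _]]]|psi1 IH1 psi2 IH2 /andP[pd1 pd2]].
    rewrite /enabled /= orbF; apply/allP => s; rewrite mem_enum in_msupp => sp.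
    have := leq_trans sp (sE s); rewrite ffunE => /card_gt0P[s']; rewrite inE => /eqP e.
    by rewrite inE; apply/existsP; exists s'; rewrite -e; apply: usub.
  rewrite /enabled has_cat => -[/(IH1 pd1)|/(IH2 pd2)] h; apply/orP; first by left.
  by right.
by case: phi => //= *; apply: atoms.
Qed.

End Options.

Section Emptiness.
Variables (Q Sigma : finType) (A : aapta Q Sigma).
Hypothesis nonaltA : nonalternating A.
Let q0 := init_state A.
Let om := omega A.

(** The controllable predecessor of the game: from such a [q] the automaton can force the next state
    into [Y]. *)
Definition cpre (Y : {set Q}) : {set Q} :=
  [set q | [exists sigma, enabled Y (delta A q sigma)]].

Lemma cpre_mono : mono cpre.
Proof.
move=> Y Z sYZ; apply/subsetP=> q; rewrite !inE => /existsP[sigma h].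
apply/existsP; exists sigma; apply: sub_has h => ss /allP h.
by apply/allP=> s /h; apply: (subsetP sYZ).
Qed.

Section AutomatonWins.
Variables (W : {set Q}) (S : Q -> {set Q}).
Hypotheses (SW : forall q, q \in W -> q \in cpre (S q) /\ S q \subset W)
  (pathW : forall b : nat -> Q, b 0 \in W -> (forall i, b i.+1 \in S (b i)) ->
             parity_win om odd b) (q0W : q0 \in W).

(** The tree is the unfolding of the strategy, and its directions carry it: direction [(s, i)] leads
    to the [i]-th copy of [s] required by the multiset chosen at the current state, and exists when
    [i] is below the multiplicity. The execution tree copies the state component, so every branch is
    a play of [S]. *)
Lemma language_inhabited : exists T, language A T.
Proof.
have [sigma0 _] : exists sigma : Sigma, true.
  by have [] := SW q0W; rewrite inE => /existsP[s _]; exists s.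
have [Em HEm] : exists Em : Q -> Sigma * multiset Q, forall q, q \in W ->
    msupp (Em q).2 \subset S q /\
    forall (S' : finType) (nu : marking S' Q) (u : S' -> Q),
      unitary_submarking nu u -> image_multiset u = (Em q).2 ->
      marking_sat nu (delta A q (Em q).1).
  have ex (q : Q) : exists p : Sigma * multiset Q, q \in W ->
      msupp p.2 \subset S q /\
      forall (S' : finType) (nu : marking S' Q) (u : S' -> Q),
        unitary_submarking nu u -> image_multiset u = p.2 ->
        marking_sat nu (delta A q p.1).
    case qW: (q \in W); last by exists (sigma0, [ffun=> 0]).
    have [] := SW qW; rewrite inE => /existsP[s /enabled_realised].
    by case=> // E sE hE _; exists (s, E).
  exact (fin_all_exists ex).
(* Any common bound on the multiplicities would do; it makes the set of directions finite. *)
pose K := \sum_(q : Q) \sum_(s : Q) (Em q).2 s.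
have leK q s : (Em q).2 s <= K.
  by rewrite /K (bigD1 q) //= (bigD1 s) //= -addnA leq_addr.
pose D : finType := (Q * 'I_K)%type.
pose fix node q (m : seq D) : bool :=
  if m is d :: m' then (d.2 < (Em q).2 d.1) && node d.1 m' else true.
have node_cat q m m' : node q (m ++ m') = node q m && node (last q (unzip1 m)) m'.
  by elim: m q => //= d m IH q; rewrite IH andbA.
have treeN : is_tree (node q0).
  by split=> // m m'; rewrite node_cat => /andP[].
pose T := LTree (fun m : seq D => (Em (last q0 (unzip1 m))).1) treeN.
pose X : pred (seq (D * Q)) :=
  fun x => node q0 (unzip1 x) && (unzip2 x == unzip1 (unzip1 x)).
have X_state x : X x -> @node_state _ _ A T x = last q0 (unzip1 (unzip1 x)).
  by case/andP=> _ /eqP e; rewrite /node_state e.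
have X_rcons x d q : X x ->
    X (rcons x (d, q)) = (d.2 < (Em (@node_state _ _ A T x)).2 d.1) && (q == d.1).
  move=> Xx; have := X_state x Xx; case/andP: (Xx) => n2 /eqP e2 st.
  rewrite /X /unzip1 /unzip2 !map_rcons -cats1 node_cat -/(unzip1 _) n2 /=.
  rewrite -/(unzip1 _) -st andbT; congr (_ && _).
  rewrite -/(unzip2 _) e2 /unzip1 eqseq_rcons eqxx //.
have X_W x : X x -> @node_state _ _ A T x \in W.
  elim/last_ind: x => [|x [d q] IH] Xx; first exact: q0W.
  have Xx' : X x.
    case/andP: Xx; rewrite /unzip1 /unzip2 !map_rcons -cats1 node_cat => /andP[n2 _].
    by rewrite eqseq_rcons => /andP[e _]; rewrite /X n2.
  move: Xx; rewrite X_rcons // => /andP[lt /eqP ->].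
  rewrite /node_state /unzip2 map_rcons last_rcons /=.
  have [/subsetP h _] := HEm _ (IH Xx').
  have [_ /subsetP] := SW (IH Xx'); apply; apply: h; rewrite in_msupp.
  exact: leq_ltn_trans lt.
exists T, X; split.
- split.
  + split=> // x x'; rewrite /X /unzip1 /unzip2 !map_cat node_cat => /andP[/andP[-> _]].
    by rewrite eqseq_cat ?size_map // => /andP[-> _].
  + by move=> x /andP[].
  move=> x Xx; rewrite /= -X_state //.
  have [_ h] := HEm _ (X_W x Xx).
  apply: (h _ _ (fun d : @successors _ T (node_pos x) => (val d).1)).
    by move=> [d nd]; rewrite inE X_rcons //= eqxx andbT; move: nd;
      rewrite /= -cats1 node_cat /= andbT => /andP[_]; rewrite -X_state.
  (* The successors sent to [s] are the directions [(s, i)] with [i] below [E s], so they number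
     exactly [E s]. *)
  apply/ffunP=> s; rewrite ffunE; set E := (Em _).2.
  have inj : injective (fun i : 'I_(E s) => ((s, widen_ord (leK _ s) i) : D)).
    by move=> i j [] /val_inj.
  transitivity #|[set d : D | (d.1 == s) && (d.2 < E s)]|.
    rewrite -(card_imset _ val_inj); apply: eq_card => d; apply/imsetP/idP.
      case=> d'; rewrite !inE => /eqP <- ->.
      rewrite eqxx /=; case: d' => d' /=.
      by rewrite -cats1 node_cat /= andbT => /andP[_]; rewrite -X_state.
    rewrite inE => /andP[/eqP e lt].
    have nd : ltree_node (l := T) (rcons (node_pos x) d).
      rewrite /= -cats1 node_cat /= andbT -X_state // e lt andbT.
      by case/andP: Xx.
    by exists (Sub d nd); rewrite ?SubK // inE SubK e.
  rewrite -[RHS]card_ord -(card_imset _ inj); apply: eq_card => d.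
  apply/idP/imsetP => [|[i _ ->]]; last by rewrite inE /= eqxx ltn_ord.
  rewrite inE; case: d => s' i /= /andP[/eqP -> lt].
  by exists (Ordinal lt) => //; congr (_, _); apply: val_inj.
move=> b bX; pose c k := @node_state _ _ A T (mkseq b k).
have cX k := X_W _ (bX k).
apply: (pathW (b := c)) => // i.
have := bX i.+1; rewrite /c mkseqS; case e: (b i) => [d q].
rewrite X_rcons // => /andP[lt /eqP ->].
rewrite {1}/node_state /unzip2 map_rcons last_rcons /=.
have [/subsetP h _] := HEm _ (cX i).
by apply: h; rewrite in_msupp; apply: leq_ltn_trans lt.
Qed.

End AutomatonWins.

Section PathfinderWins.
Variables (L : {set Q}) (S : Q -> {set Q}).
Hypotheses (SL : forall q, q \in L -> q \in dual cpre (S q) /\ S q \subset L)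
  (pathL : forall b : nat -> Q, b 0 \in L -> (forall i, b i.+1 \in S (b i)) ->
             parity_win om (fun p => ~~ odd p) b) (q0L : q0 \in L).

(** The opponent walks down an accepting execution tree. The states spawned at a node enable its
    formula, while the complement of [S q] enables none at [q], so some spawned state lies in [S q].
    Choosing one forever yields an infinite branch whose least recurring priority would be both even
    and odd. *)
Lemma language_is_empty : language_empty A.
Proof.
move=> T [X [[[X0 _] _ satX] accX]].
pose D := ltree_dir T.
pose good (x : seq (D * Q)) (p : D * Q) :=
  X (rcons x p) && (p.2 \in S (@node_state _ _ A T x)).
have good_ex x : X x -> @node_state _ _ A T x \in L -> exists p, good x p.
  move=> Xx xL; apply: NNPP => no.
  have [xd _] := SL xL; move: xd; rewrite /dual !inE => /negP; apply.
  have := marking_sat_enabled (nonaltA _ _) (satX x Xx).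
  set V := [set q | _] => en; apply/existsP.
  exists (ltree_lab (node_pos x)); apply: sub_has en => ss /allP h.
  apply/allP=> s /h; rewrite !inE => /existsP[d]; rewrite inE => Xd.
  by apply/negP=> sS; apply: no; exists (val d, s); rewrite /good Xd.
have [p0 _] := good_ex [::] X0 q0L.
(* [p0] is a default for words without a good continuation; along [g] one always exists. *)
pose b' x := odflt p0 [pick p | good x p].
pose g k := iter k (fun x => rcons x (b' x)) [::].
pose b k := b' (g k).
have gE k : mkseq b k = g k by elim: k => // k IH; rewrite mkseqS IH.
have gP k : X (g k) /\ @node_state _ _ A T (g k) \in L.
  elim: k => // k [Xk kL]; rewrite /g iterS -/(g k).
  have [p gp] := good_ex _ Xk kL; rewrite /b'; case: pickP => [p' /=|/(_ p)]; last by rewrite gp.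
  case/andP=> Xp pS; split=> //; rewrite /node_state /unzip2 map_rcons last_rcons.
  by have [_ /subsetP] := SL kL; apply.
have gS k : @node_state _ _ A T (g k.+1) \in S (@node_state _ _ A T (g k)).
  have [Xk kL] := gP k; rewrite {1}/g iterS -/(g k).
  have [p gp] := good_ex _ Xk kL; rewrite /b'; case: pickP => [p' /=|/(_ p)]; last by rewrite gp.
  by case/andP=> Xp pS; rewrite {1}/node_state /unzip2 map_rcons last_rcons.
have [|p [iop minp evp]] := accX b; first by move=> k; rewrite gE; case: (gP k).
have [p' [iop' minp' oddp]] := pathL (b := fun k => @node_state _ _ A T (g k)) q0L gS.
have io r : seen_infinitely_often A b r <-> inf_often om (fun k => @node_state _ _ A T (g k)) r.
  by split=> h n; have [k lek e] := h n; exists k => //; rewrite -e gE.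
have e : p = p' by apply/eqP; rewrite eqn_leq minp ?minp' //; apply/io.
by move: oddp; rewrite -e evp.
Qed.

End PathfinderWins.

(** Each player has a positional strategy on its own side, and the two sides are complementary by
    [nested_fix_dual]. *)
Lemma winning_region M Y : (forall q, om q < M) -> is_default om odd 0 Y ->
  (q0 \in nested_fix om cpre M 0 Y) <-> ~ language_empty A.
Proof.
move=> ltM dY; split=> [q0W ne|].
  have [S [S1 S2]] := strategy_exists cpre_mono (j := M) (k := 0) ltM dY.
  have [|b b0 bS|T lT] := @language_inhabited (nested_fix om cpre M 0 Y) S _ _ q0W.
  - by move=> q /S1[h1 h2]; split=> //; apply/subsetP=> s /h2.
  - exact: S2.
  exact: ne lT.
apply: contra_notT; rewrite -in_setC -nested_fix_dual => q0L.
have [S [S1 S2]] := strategy_exists (dual_mono cpre_mono) (j := M) (k := 0) ltM (is_defaultC dY).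
apply: (@language_is_empty _ S _ _ q0L).
- by move=> q /S1[h1 h2]; split=> //; apply/subsetP=> s /h2.
- by move=> b b0 bS; apply: S2.
Qed.

End Emptiness.

(** * A language with arrays on top of the machine *)

(* Execution counts one unit per assignment and per test; [step_cost] converts
   units of a compiled program into machine steps. *)
Inductive hexp :=
| HC of nat
| HV of nat
| HAdd of hexp & hexp
| HSub of hexp & hexp
| HHalf of hexp
| HGet of nat & hexp.

Inductive htest := HNe of hexp & hexp | HLt of hexp & hexp.

Inductive hcmd :=
| HSet of nat & hexp
| HPut of nat & hexp & hexp
| HSeq of hcmd & hcmd
| HIf of htest & hcmd & hcmd
| HWhile of htest & hcmd.

Record hst := HSt { hreg : nat -> nat; harr : nat -> nat -> nat }.

(** The test is [Nat.eqb], and a full application unfolds, so that simplification resolves accesses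
    to concrete registers and arrays. *)
Definition setf T (f : nat -> T) (i : nat) (v : T) : nat -> T :=
  fun j => if Nat.eqb j i then v else f j.
Arguments setf T f i v j /.

Lemma setfE T (f : nat -> T) i v j : setf f i v j = if j == i then v else f j.
Proof. by rewrite /setf; case: eqVneq => [->|/eqP/PeanoNat.Nat.eqb_neq->] //; rewrite PeanoNat.Nat.eqb_refl. Qed.

Lemma upd_setf f i v j : upd f i v j = setf f i v j.
Proof. by rewrite setfE. Qed.

Definition setV st r v := HSt (setf (hreg st) r v) (harr st).
Definition setA st a i v := HSt (hreg st) (setf (harr st) a (setf (harr st a) i v)).

Fixpoint heval st e :=
  match e with
  | HC n => n
  | HV r => hreg st r
  | HAdd e1 e2 => heval st e1 + heval st e2
  | HSub e1 e2 => heval st e1 - heval st e2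
  | HHalf e1 => (heval st e1)./2
  | HGet a e1 => harr st a (heval st e1)
  end.

Definition htrue st t :=
  match t with
  | HNe e1 e2 => heval st e1 != heval st e2
  | HLt e1 e2 => heval st e1 < heval st e2
  end.

Inductive hexec : hcmd -> hst -> nat -> hst -> Prop :=
| HExecSet r e st : hexec (HSet r e) st 1 (setV st r (heval st e))
| HExecPut a i e st : hexec (HPut a i e) st 1 (setA st a (heval st i) (heval st e))
| HExecSeq c1 c2 st1 st2 st3 n1 n2 :
    hexec c1 st1 n1 st2 -> hexec c2 st2 n2 st3 -> hexec (HSeq c1 c2) st1 (n1 + n2) st3
| HExecIf t c1 c2 st st' n :
    hexec (if htrue st t then c1 else c2) st n st' -> hexec (HIf t c1 c2) st n.+1 st'
| HExecWhileTrue t c st1 st2 st3 n1 n2 :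
    htrue st1 t -> hexec c st1 n1 st2 -> hexec (HWhile t c) st2 n2 st3 ->
    hexec (HWhile t c) st1 (n1 + n2).+1 st3
| HExecWhileFalse t c st : ~~ htrue st t -> hexec (HWhile t c) st 1 st.

(** * Frame properties and timed execution rules *)

Section Frame.

Fixpoint wrV c (r : nat) : bool :=
  match c with
  | HSet r' _ => Nat.eqb r r'
  | HPut _ _ _ => false
  | HSeq c1 c2 | HIf _ c1 c2 => wrV c1 r || wrV c2 r
  | HWhile _ c1 => wrV c1 r
  end.

Fixpoint wrA c (a : nat) : bool :=
  match c with
  | HSet _ _ => false
  | HPut a' _ _ => Nat.eqb a a'
  | HSeq c1 c2 | HIf _ c1 c2 => wrA c1 a || wrA c2 a
  | HWhile _ c1 => wrA c1 a
  end.

Lemma hexec_frame c st n st' : hexec c st n st' ->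
  (forall r, wrV c r = false -> hreg st' r = hreg st r) /\
  (forall a, wrA c a = false -> harr st' a = harr st a).
Proof.
elim=> {c st n st'} /=.
- by move=> r e st; split=> // r' h; rewrite /= h.
- by move=> a i e st; split=> // a' h; rewrite /= h.
- move=> c1 c2 st1 st2 st3 n1 n2 _ [v1 a1] _ [v2 a2].
  by split=> x /negbT/norP[/negbTE h1 /negbTE h2]; rewrite ?v2 ?v1 ?a2 ?a1.
- move=> t c1 c2 st st' n _ [v1 a1].
  split=> x /negbT/norP[/negbTE h1 /negbTE h2]; rewrite ?v1 ?a1 //; by case: ifP.
- by move=> t c st1 st2 st3 n1 n2 _ _ [v1 a1] _ [v2 a2]; split=> x h; rewrite ?v2 ?v1 ?a2 ?a1.
- by [].
Qed.

End Frame.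

(** Total correctness within a budget of [u] units, in the style of a weakest precondition:
    sequencing nests [hrun] in the postcondition. *)
Definition hrun c st u (P : hst -> Prop) :=
  exists k st', [/\ hexec c st k st', k <= u & P st'].

Lemma hrun_weaken c st u u' (P P' : hst -> Prop) :
  hrun c st u P -> u <= u' -> (forall st', P st' -> P' st') -> hrun c st u' P'.
Proof.
by case=> k [st' [ex le p]] leu sub; exists k, st'; split; [|apply: leq_trans leu|apply: sub].
Qed.

Lemma hrun_frame c st u P : hrun c st u P ->
  hrun c st u (fun st' => [/\ P st',
    forall r, wrV c r = false -> hreg st' r = hreg st r &
    forall a, wrA c a = false -> harr st' a = harr st a]).
Proof.
case=> k [st' [ex le p]]; exists k, st'; split=> //.
by case: (hexec_frame ex).
Qed.

Lemma hrun_seq c1 c2 st u1 u2 P :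
  hrun c1 st u1 (fun st' => hrun c2 st' u2 P) -> hrun (HSeq c1 c2) st (u1 + u2) P.
Proof.
case=> k [st' [ex le [k' [st2 [ex' le' p]]]]]; exists (k + k'), st2.
by split=> //; [apply: HExecSeq ex ex' | apply: leq_add].
Qed.

Lemma hrun_while_true t c st u1 u2 P : htrue st t ->
  hrun c st u1 (fun st' => hrun (HWhile t c) st' u2 P) ->
  hrun (HWhile t c) st (u1 + u2).+1 P.
Proof.
move=> tt; case=> k [st' [ex le [k' [st2 [ex' le' p]]]]]; exists (k + k').+1, st2.
by split=> //; [apply: HExecWhileTrue ex ex' | rewrite ltnS; apply: leq_add].
Qed.

Lemma hrun_while_false t c st u (P : hst -> Prop) :
  ~~ htrue st t -> P st -> 0 < u -> hrun (HWhile t c) st u P.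
Proof. by move=> tt p u0; exists 1, st; split=> //; apply: HExecWhileFalse. Qed.

Lemma hrun_if t c1 c2 st u P :
  hrun (if htrue st t then c1 else c2) st u P -> hrun (HIf t c1 c2) st u.+1 P.
Proof. by case=> k [st' [ex le p]]; exists k.+1, st'; split=> //; constructor. Qed.

Fixpoint loopfree c :=
  match c with
  | HSet _ _ | HPut _ _ _ => true
  | HSeq c1 c2 | HIf _ c1 c2 => loopfree c1 && loopfree c2
  | HWhile _ _ => false
  end.

Fixpoint hsem c st :=
  match c with
  | HSet r e => setV st r (heval st e)
  | HPut a i e => setA st a (heval st i) (heval st e)
  | HSeq c1 c2 => hsem c2 (hsem c1 st)
  | HIf t c1 c2 => if htrue st t then hsem c1 st else hsem c2 st
  | HWhile _ _ => st
  end.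

Fixpoint hlen c :=
  match c with
  | HSet _ _ | HPut _ _ _ => 1
  | HSeq c1 c2 => hlen c1 + hlen c2
  | HIf _ c1 c2 => (maxn (hlen c1) (hlen c2)).+1
  | HWhile _ _ => 0
  end.

Lemma hexec_loopfree c st : loopfree c -> exists2 k, k <= hlen c & hexec c st k (hsem c st).
Proof.
elim: c st => [r e|a i e|c1 IH1 c2 IH2|t c1 IH1 c2 IH2|t c _] st //=.
- by exists 1 => //; constructor.
- by exists 1 => //; constructor.
- case/andP=> /IH1-/(_ st)[k1 le1 ex1] /IH2-/(_ (hsem c1 st))[k2 le2 ex2].
  by exists (k1 + k2); [apply: leq_add | apply: HExecSeq ex1 ex2].
- case/andP=> /IH1-/(_ st)[k1 le1 ex1] /IH2-/(_ st)[k2 le2 ex2].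
  case E: (htrue st t).
    by exists k1.+1; [rewrite ltnS leq_max le1 | constructor; rewrite E].
  by exists k2.+1; [rewrite ltnS leq_max le2 orbT | constructor; rewrite E].
Qed.

(** Loop-free code is verified by computation: [hsem c st] simplifies to the final state, and [hlen]
    bounds the longest path. *)
Lemma hrun_block c st u (P : hst -> Prop) :
  loopfree c -> hlen c <= u -> P (hsem c st) -> hrun c st u P.
Proof.
move=> lf le p; have [k lek ex] := hexec_loopfree st lf.
by exists k, (hsem c st); split=> //; apply: leq_trans le.
Qed.

Lemma hrun_block_seq c c' st u P :
  loopfree c -> hrun c' (hsem c st) u P -> hrun (HSeq c c') st (hlen c + u) P.
Proof. by move=> lf r; apply: hrun_seq; apply: hrun_block. Qed.

(** * Compilation for an arbitrary memory layout *)

Section Compilation.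
Variable addr : nat -> expr -> expr.

Fixpoint cexp e :=
  match e with
  | HC n => Const n
  | HV r => Reg r
  | HAdd e1 e2 => Add (cexp e1) (cexp e2)
  | HSub e1 e2 => Defs.Sub (cexp e1) (cexp e2)
  | HHalf e1 => Half (cexp e1)
  | HGet a e1 => Fetch (addr a (cexp e1))
  end.

Definition ctest t :=
  match t with
  | HNe e1 e2 => Add (Defs.Sub (cexp e1) (cexp e2)) (Defs.Sub (cexp e2) (cexp e1))
  | HLt e1 e2 => Defs.Sub (cexp e2) (cexp e1)
  end.

Fixpoint compile c :=
  match c with
  | HSet r e => Assign r (cexp e)
  | HPut a i e => Store (addr a (cexp i)) (cexp e)
  | HSeq c1 c2 => Seq (compile c1) (compile c2)
  | HIf t c1 c2 => If (ctest t) (compile c1) (compile c2)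
  | HWhile t c1 => While (ctest t) (compile c1)
  end.

(** The cost of the whole program text, each expression counted once. Summing over branches and
    bodies makes it dominate every subprogram, so it serves as a uniform factor per unit in
    [compile_exec]. *)
Fixpoint step_cost c :=
  match c with
  | HSet r e => 1 + expr_cost (cexp e)
  | HPut a i e => 1 + expr_cost (addr a (cexp i)) + expr_cost (cexp e)
  | HSeq c1 c2 => step_cost c1 + step_cost c2
  | HIf t c1 c2 => 1 + expr_cost (ctest t) + (step_cost c1 + step_cost c2)
  | HWhile t c1 => 1 + expr_cost (ctest t) + step_cost c1
  end.

Variables (readable writable assignable : pred nat) (rep : hst -> ram_state -> Prop).
Hypotheses
  (rep_V : forall st s r, rep st s -> regs s r = hreg st r)
  (rep_get : forall st s a e, rep st s -> readable a ->
     Defs.mem s (eval s (addr a e)) = harr st a (eval s e))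
  (rep_set : forall st s r v, rep st s -> assignable r ->
     rep (setV st r v) (RamState (upd (regs s) r v) (Defs.mem s)))
  (rep_put : forall st s a e v, rep st s -> writable a ->
     rep (setA st a (eval s e) v) (RamState (regs s) (upd (Defs.mem s) (eval s (addr a e)) v))).

Fixpoint wf_exp e :=
  match e with
  | HC _ | HV _ => true
  | HAdd e1 e2 | HSub e1 e2 => wf_exp e1 && wf_exp e2
  | HHalf e1 => wf_exp e1
  | HGet a e1 => readable a && wf_exp e1
  end.

Definition wf_test t :=
  match t with HNe e1 e2 | HLt e1 e2 => wf_exp e1 && wf_exp e2 end.

Fixpoint wf c :=
  match c with
  | HSet r e => assignable r && wf_exp e
  | HPut a i e => [&& writable a, wf_exp i & wf_exp e]
  | HSeq c1 c2 => wf c1 && wf c2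
  | HIf t c1 c2 => [&& wf_test t, wf c1 & wf c2]
  | HWhile t c1 => wf_test t && wf c1
  end.

Lemma eval_cexp st s e : rep st s -> wf_exp e -> eval s (cexp e) = heval st e.
Proof.
move=> rs; elim: e => //= [r _|e1 IH1 e2 IH2|e1 IH1 e2 IH2|e IH|a e IH].
- exact: rep_V.
- by case/andP=> /IH1-> /IH2->.
- by case/andP=> /IH1-> /IH2->.
- by move=> /IH->.
- by case/andP=> ra /IH<-; apply: rep_get.
Qed.

Lemma eval_ctest st s t : rep st s -> wf_test t -> (eval s (ctest t) != 0) = htrue st t.
Proof. by move=> rs; case: t => e1 e2 /= /andP[w1 w2]; rewrite !(eval_cexp rs) //; lia. Qed.

Lemma compile_exec c st k st' s : hexec c st k st' -> rep st s -> wf c ->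
  exists k' s', [/\ exec (compile c) s k' s', k' <= step_cost c * k & rep st' s'].
Proof.
move=> ex; elim: ex s => {c st k st'} /=.
- move=> r e st s rs /andP[ok we]; exists (1 + expr_cost (cexp e)).
  eexists; split; [by constructor | by rewrite muln1 |].
  by rewrite (eval_cexp rs) //; apply: rep_set.
- move=> a i e st s rs /and3P[ok wi we]; eexists; eexists; split; [by constructor | by rewrite muln1 |].
  by rewrite (eval_cexp rs we) -(eval_cexp rs wi); apply: rep_put.
- move=> c1 c2 st1 st2 st3 n1 n2 _ IH1 _ IH2 s rs /andP[w1 w2].
  have [k1 [s1 [e1 le1 r1]]] := IH1 s rs w1; have [k2 [s2 [e2 le2 r2]]] := IH2 s1 r1 w2.
  exists (k1 + k2), s2; split=> //; first by apply: ExecSeq e1 e2.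
  by nia.
- move=> t c1 c2 st st' n _ IH s rs /and3P[wt w1 w2]; move: IH.
  have := eval_ctest rs wt; case: (htrue st t) => et IH; have [//|k' [s' [ex le r']]] := IH s rs.
    exists (1 + expr_cost (ctest t) + k'), s'; split=> //; first by apply: ExecIfTrue.
    by nia.
  exists (1 + expr_cost (ctest t) + k'), s'; split=> //.
    by apply: ExecIfFalse => //; apply/eqP; rewrite -[_ == _]negbK et.
  by nia.
- move=> t c st1 st2 st3 n1 n2 tt _ IH1 _ IH2 s rs /andP[wt w1].
  have [k1 [s1 [e1 le1 r1]]] := IH1 s rs w1.
  have [|k2 [s2 [e2 le2 r2]]] := IH2 s1 r1; first by rewrite wt.
  exists (1 + expr_cost (ctest t) + k1 + k2), s2; split=> //.
    by apply: ExecWhileTrue e1 e2; rewrite (eval_ctest rs).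
  by nia.
- move=> t c st tt s rs /andP[wt w1]; exists (1 + expr_cost (ctest t)), s; split=> //.
    by apply: ExecWhileFalse; apply/eqP; rewrite -[_ == _]negbK (eval_ctest rs).
  by rewrite muln1 leq_addr.
Qed.

Lemma compile_run c st u P s : hrun c st u P -> rep st s -> wf c ->
  exists k s' st', [/\ exec (compile c) s k s', k <= step_cost c * u, rep st' s' & P st'].
Proof.
case=> k [st' [ex le p]] rs wc; have [k' [s' [ex' le' rs']]] := compile_exec ex rs wc.
by exists k', s', st'; split=> //; apply: leq_trans le' _; rewrite leq_mul2l le orbT.
Qed.

End Compilation.

Section Layouts.

(* Before the length of the input is known only array 0, the raw memory, is used. *)
Definition raw_addr (a : nat) (e : expr) := e.
Definition raw_rep st s := (forall r, regs s r = hreg st r) /\ (forall i, Defs.mem s i = harr st 0 i).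

Lemma raw_run c st u P s : hrun c st u P -> raw_rep st s ->
  wf (pred1 0) pred0 predT c ->
  exists k s' st', [/\ exec (compile raw_addr c) s k s',
    k <= step_cost raw_addr c * u, raw_rep st' s' & P st'].
Proof.
apply: compile_run => {}st {}s.
- by move=> r [].
- by move=> a e [_ rm] /eqP->; apply: rm.
- by move=> r v [rr rm] _; split=> // r'; rewrite [LHS]upd_setf /= rr.
- by [].
Qed.

(* Sixteen arrays are interleaved above the address held in register 1. *)
Definition dbl e := Add e e.
Definition arr_addr a e := Add (Add (Reg 1) (Const a)) (dbl (dbl (dbl (dbl e)))).
Definition arr_rep st s := (forall r, regs s r = hreg st r) /\
  (forall a i, a < 16 -> Defs.mem s (hreg st 1 + a + 16 * i) = harr st a i).

Lemma arr_run c st u P s : hrun c st u P -> arr_rep st s ->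
  wf (fun a => a < 16) (fun a => a < 16) (fun r => r != 1) c ->
  exists k s' st', [/\ exec (compile arr_addr c) s k s',
    k <= step_cost arr_addr c * u, arr_rep st' s' & P st'].
Proof.
have addrE st' s' a e : arr_rep st' s' -> eval s' (arr_addr a e) = hreg st' 1 + a + 16 * eval s' e.
  by case=> rr _ /=; rewrite rr; lia.
apply: compile_run => {}st {}s.
- by move=> r [].
- by move=> a e rs lta; rewrite (addrE st) //; apply: rs.2.
- move=> r v [rr rm] nr; split=> [r'|a i lta /=]; first by rewrite [LHS]upd_setf /= rr.
  by rewrite -[RHS]rm //; congr (Defs.mem _ (_ + _ + _)); move: nr; case: r => [|[|r]].
- move=> a e v rs lta; split=> [r|a' i lta']; first by case: rs => + _; apply.
  rewrite -[LHS]/(upd (Defs.mem s) (eval s (arr_addr a e)) v (hreg st 1 + a' + 16 * i)).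
  rewrite (addrE st) // /upd -[RHS]/(setf (harr st) a (setf (harr st a) (eval s e) v) a' i) setfE.
  case: (eqVneq a' a) => [ea|nea]; last first.
    by case: eqVneq => [e'|ne]; [lia | apply: rs.2].
  rewrite setfE ea; case: (eqVneq i (eval s e)) => [ei|nei]; first by rewrite ei eqxx.
  by case: eqVneq => [e'|ne]; [lia | apply: rs.2; rewrite -ea].
Qed.

End Layouts.

Declare Scope hcmd_scope.
Delimit Scope hcmd_scope with H.
Notation "c1 ;; c2" := (HSeq c1 c2) (at level 62, right associativity) : hcmd_scope.
Notation "r <~ e" := (HSet r e) (at level 60) : hcmd_scope.
Local Open Scope hcmd_scope.

(** * The decision procedure *)

(* Arrays: 0 the input; 1 first edge of a state, 2 next edge, 3 option of an
   edge; 4 owner of an option; 5 and 6 initial and current counter of an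
   option, 7 and 8 of a state; 9 current assignment; 10 worklist. An option is
   named by the position of its token in the input, an edge by the position of
   the successor state it stands for. Register 1 holds the length of the input. *)
Local Notation rn := 2 (only parsing).
Local Notation rsigma := 3 (only parsing).
Local Notation rpos := 4 (only parsing).
Local Notation rpend := 5 (only parsing).
Local Notation rq := 6 (only parsing).
Local Notation rtok := 7 (only parsing).
Local Notation rj := 8 (only parsing).
Local Notation ro := 9 (only parsing).
Local Notation re := 10 (only parsing).
Local Notation rs := 11 (only parsing).
Local Notation rx := 12 (only parsing).
Local Notation ry := 13 (only parsing).
Local Notation rpm := 14 (only parsing).
Local Notation rbeta := 15 (only parsing).
Local Notation rsp := 16 (only parsing).
Local Notation rk := 17 (only parsing).
Local Notation ri := 18 (only parsing).
Local Notation incr r := (HSet r (HAdd (HV r) (HC 1))).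
Local Notation decr r := (HSet r (HSub (HV r) (HC 1))).
Local Notation skip := (HSet 19 (HC 0)).
Local Notation hfor x y c := (HWhile (HLt (HV x) (HV y)) (c ;; incr x)).
Local Notation pos e := (HLt (HC 0) e).

Definition parity_exp e := HSub e (HAdd (HHalf e) (HHalf e)).

(** Polish notation is traversed without a stack: [rpend] counts the formulas still to be read. A
    disjunction token replaces one of them by two, every other token completes one. An atom occupies
    3 + 2j + u words, for j elements of the support and u of [U]. *)
Definition skip_body : hcmd :=
  rtok <~ HGet 0 (HV rpos) ;;
  HIf (HNe (HV rtok) (HC 3))
    (decr rpend ;;
     HIf (HLt (HV rtok) (HC 2)) (incr rpos)
       (rj <~ HGet 0 (HAdd (HV rpos) (HC 1)) ;;
        rx <~ HGet 0 (HAdd (HV rpos) (HAdd (HC 2) (HAdd (HV rj) (HV rj)))) ;;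
        rpos <~ HAdd (HV rpos) (HAdd (HC 3) (HAdd (HAdd (HV rj) (HV rj)) (HV rx)))))
    (incr rpend ;; incr rpos).

Definition skip_loop := HWhile (pos (HV rpend)) skip_body.

(** The length of the input is not given, so it is found by parsing, before anything is stored: the
    arrays are placed above the input. The number of formulas comes from repeated addition, as the
    machine cannot multiply. *)
Definition measure_input : hcmd :=
  (rn <~ HGet 0 (HC 0) ;; rsigma <~ HGet 0 (HC 1) ;; rpend <~ HC 0 ;; rq <~ HC 0) ;;
  hfor rq rn (rpend <~ HAdd (HV rpend) (HV rsigma)) ;;
  rpos <~ HAdd (HC 3) (HV rn) ;;
  skip_loop ;;
  (1 <~ HV rpos ;; ri <~ HC 0).

Section Generic.

Lemma hrun_for x y c (u : nat -> nat) (I : nat -> hst -> Prop) N k st :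
  k <= N -> I k st ->
  (forall i st, I i st -> hreg st x = i /\ hreg st y = N) ->
  (forall i st, i < N -> I i st -> hrun (c ;; incr x) st (u i) (I i.+1)) ->
  hrun (hfor x y c) st ((\sum_(k <= i < N) (u i).+1) + 1) (I N).
Proof.
move=> + + Ixy step; move=> /subnKC; move: (N - k) => m.
elim: m k st => [|m IH] k st eN Ik.
  rewrite addn0 in eN; rewrite -eN in Ixy *; rewrite big_geq //.
  by apply: hrun_while_false => //=; have [-> ->] := Ixy _ _ Ik; rewrite ltnn.
have ltkN : k < N by lia.
rewrite big_ltn // !addSn -addnA; apply: hrun_while_true => /=.
  by have [-> ->] := Ixy _ _ Ik.
apply: hrun_weaken (step _ _ ltkN Ik) (leqnn _) _ => st' Ik'.
by apply: IH => //; lia.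
Qed.

Lemma hrun_for_cst x y c u (I : nat -> hst -> Prop) N st :
  I 0 st ->
  (forall i st, I i st -> hreg st x = i /\ hreg st y = N) ->
  (forall i st, i < N -> I i st -> hrun (c ;; incr x) st u (I i.+1)) ->
  hrun (hfor x y c) st (N * u.+1 + 1) (I N).
Proof.
move=> I0 Ixy step; have := hrun_for (u := fun=> u) (leq0n N) I0 Ixy step.
by rewrite sum_nat_const_nat subn0.
Qed.

Lemma drop_eq_cons (s : seq nat) p x r : drop p s = x :: r -> nth 0 s p = x /\ drop p.+1 s = r.
Proof.
move=> e; split; first by rewrite -[p]addn0 -nth_drop e.
by rewrite -addn1 addnC -drop_drop e drop1.
Qed.

Lemma drop_append (s : seq nat) p a b : drop p s = a ++ b -> drop (p + size a) s = b.
Proof. by move=> e; rewrite addnC -drop_drop e drop_size_cat. Qed.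

Lemma nth_append (s : seq nat) p a x b :
  drop p s = a ++ x :: b -> nth 0 s (p + size a) = x.
Proof. by move=> e; rewrite -nth_drop e nth_cat ltnn subnn. Qed.

End Generic.

(** * Polish notation and the length of the input *)

Section Encoding.
Variable Q : finType.
Implicit Types phi : eu_constr Q.

Fixpoint no_and phi :=
  match phi with
  | EUand _ _ => false
  | EUor a b => no_and a && no_and b
  | _ => true
  end.

Lemma nonalternating_no_and phi : nonalternating_constr phi -> no_and phi.
Proof.
have pd psi : pair_disjunction psi -> no_and psi.
  by elim: psi => //= a IHa b IHb /andP[/IHa-> /IHb->].
by case: phi => //= a b; apply: (pd (EUor a b)).
Qed.

Definition code_elems (E : multiset Q) (ss : seq Q) :=
  flatten [seq [:: code_state s; E s] | s <- ss].

Lemma size_code_elems E ss : size (code_elems E ss) = size ss + size ss.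
Proof. by elim: ss => //= s ss; rewrite /code_elems /= => ->; lia. Qed.

Lemma code_atom_cat (p : eu_pair Q) r : code_constr (EUatom p) ++ r =
  4 :: #|msupp (eu_E p)| :: code_elems (eu_E p) (enum (msupp (eu_E p))) ++
    #|eu_U p| :: [seq code_state s | s <- enum (eu_U p)] ++ r.
Proof. by rewrite /= -catA. Qed.

Lemma size_code_atom (p : eu_pair Q) : size (code_constr (EUatom p)) =
  3 + (#|msupp (eu_E p)| + #|msupp (eu_E p)|) + #|eu_U p|.
Proof.
by rewrite -[code_constr _]cats0 code_atom_cat cats0 /= size_cat size_code_elems /= size_map -!cardE; lia.
Qed.

Definition codes (phis : seq (eu_constr Q)) := flatten (map (@code_constr Q) phis).

Lemma code_lt (q : Q) : code_state q < #|Q|.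
Proof. exact: ltn_ord. Qed.

Lemma code_inj : injective (@code_state Q).
Proof. by move=> q q' /val_inj /enum_rank_inj. Qed.

Lemma code_surj i : i < #|Q| -> exists q : Q, code_state q = i.
Proof. by move=> lt; exists (enum_val (Ordinal lt)); rewrite /code_state enum_valK. Qed.

Lemma nth_enum_code T (x0 : T) (f : Q -> T) q :
  nth x0 (map f (enum Q)) (code_state q) = f q.
Proof.
by rewrite (nth_map q) ?nth_enum_rank // -cardE code_lt.
Qed.

Lemma size_code_constr phi : size (code_constr phi) <= 3 * eu_size phi.
Proof.
elim: phi => [||p|a IHa b IHb|a IHa b IHb] //.
- by rewrite size_code_atom [eu_size _]/=; lia.
- by rewrite /= size_cat; lia.
- by rewrite /= size_cat; lia.
Qed.

(** The list [phis] of pending formulas stands for a recursion stack. It grows at a disjunction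
    while the remaining code shrinks, so the induction is on the length of the code. A turn costs a
    test and at most 9 units and consumes at least one word, whence 10 per word. *)
Lemma skip_loop_run inp phis rest st :
  all no_and phis -> harr st 0 =1 nth 0 inp ->
  drop (hreg st rpos) inp = codes phis ++ rest -> hreg st rpend = size phis ->
  hrun skip_loop st (10 * size (codes phis) + 1)
    (fun st' => hreg st' rpos = hreg st rpos + size (codes phis)).
Proof.
have [m] := ubnP (size (codes phis)); elim: m => // m IH in phis rest st *.
case: phis => [|phi phis] ltm.
  move=> _ _ _ e; apply: hrun_while_false => //=; last by rewrite addn0.
  by rewrite e.
move=> nand inpE dr epend.
have next cs psis : hrun skip_body st 9 (fun st' => [/\ hreg st' rpos = hreg st rpos + size cs,
      hreg st' rpend = size psis & harr st' 0 =1 nth 0 inp]) ->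
    size cs > 0 -> codes (phi :: phis) = cs ++ codes psis -> all no_and psis ->
    hrun skip_loop st (10 * size (codes (phi :: phis)) + 1)
      (fun st' => hreg st' rpos = hreg st rpos + size (codes (phi :: phis))).
  move=> run c0 ecs npsis; rewrite ecs in ltm dr *; rewrite size_cat in ltm *.
  apply: (hrun_weaken (u := (9 + (10 * size (codes psis) + 1)).+1)) (fun=> id); last by lia.
  apply: hrun_while_true; first by rewrite /= epend.
  apply: hrun_weaken run (leqnn _) _ => st' [epos epend' inpE'].
  apply: hrun_weaken (IH psis rest st' _ npsis inpE' _ epend') (leqnn _) _.
  - by lia.
  - by rewrite epos; apply: drop_append; rewrite catA.
  - by move=> st2 ->; rewrite epos addnA.
have block : forall P : hst -> Prop, P (hsem skip_body st) -> hrun skip_body st 9 P.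
  by move=> P; apply: hrun_block.
case: phi => [||p|a b|a b] in ltm nand dr epend next *.
- apply: (next [:: 0] phis) => //; apply: block.
  have [h0 _] := drop_eq_cons dr; rewrite /= inpE h0 /=; split=> //.
  by rewrite epend /= subn1.
- apply: (next [:: 1] phis) => //; apply: block.
  have [h0 _] := drop_eq_cons dr; rewrite /= inpE h0 /=; split=> //.
  by rewrite epend /= subn1.
- apply: (next (code_constr (EUatom p)) phis) => //; apply: block.
  rewrite -[codes _]/(code_constr (EUatom p) ++ codes phis) -catA code_atom_cat in dr.
  have [h0 dr1] := drop_eq_cons dr; have [h1 dr2] := drop_eq_cons dr1; have h2 := nth_append dr2.
  rewrite size_code_elems -cardE in h2.
  have e0 : harr st 0 (hreg st rpos) = 4 by rewrite inpE h0.
  have e1 : harr st 0 (hreg st rpos + 1) = #|msupp (eu_E p)| by rewrite inpE addn1 h1.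
  have e2 : harr st 0 (hreg st rpos + (2 + (#|msupp (eu_E p)| + #|msupp (eu_E p)|))) = #|eu_U p|.
    by rewrite inpE -h2 !addSn add0n !addnS.
  rewrite size_code_atom [hsem _ _]/= e0 /= e1 e2 epend /= subn1; split=> //.
- by [].
- apply: (next [:: 3] [:: a, b & phis]) => //; last 2 first.
  + by rewrite /codes /= -catA.
  + by move: nand; rewrite /= andbA.
  apply: block; have [h0 _] := drop_eq_cons dr; rewrite /= inpE h0 /=; split=> //.
  by rewrite epend /= addn1.
Qed.

End Encoding.

(** * Building the lists of options and edges *)

Definition max_priority : hcmd :=
  (rpm <~ HC 0 ;; rq <~ HC 0) ;;
  hfor rq rn (rx <~ HGet 0 (HAdd (HC 3) (HV rq)) ;;
    HIf (HLt (HV rpm) (HV rx)) (rpm <~ HV rx) skip).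

(** Array 7 receives the threshold of a state without options, which is 1 or 0 according to the
    mode; array 9 receives the default assignment, 0 exactly at the priorities with the parity of
    the largest one. *)
Definition init_arrays : hcmd :=
  (rbeta <~ parity_exp (HV rpm) ;; rq <~ HC 0) ;;
  hfor rq rn (HPut 7 (HV rq) (HV rbeta) ;;
    rx <~ HGet 0 (HAdd (HC 3) (HV rq)) ;;
    HIf (HNe (parity_exp (HV rx)) (HV rbeta)) (HPut 9 (HV rq) (HC 1)) (HPut 9 (HV rq) (HC 0))).

Definition link_body : hcmd :=
  rs <~ HGet 0 (HV re) ;;
  HPut 2 (HV re) (HGet 1 (HV rs)) ;;
  HPut 1 (HV rs) (HV re) ;;
  HPut 3 (HV re) (HV ro) ;;
  re <~ HAdd (HV re) (HC 2) ;;
  decr rj.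

Definition link_loop := HWhile (pos (HV rj)) link_body.

Definition option_head : hcmd :=
  decr rpend ;;
  HIf (pos (HV rtok))
    (rj <~ HGet 0 (HAdd (HV rpos) (HC 1)) ;; re <~ HAdd (HV rpos) (HC 2))
    (rj <~ HC 0 ;; re <~ HAdd (HV rpos) (HC 1)) ;;
  ro <~ HV rpos ;;
  HPut 4 (HV ro) (HV rq) ;;
  HIf (pos (HV rbeta))
    (HPut 5 (HV ro) (HV rj) ;; HIf (pos (HV rj)) skip (HPut 7 (HV rq) (HC 0)))
    (HPut 5 (HV ro) (HC 1) ;; HPut 7 (HV rq) (HAdd (HGet 7 (HV rq)) (HC 1))).

Definition option_tail : hcmd :=
  HIf (pos (HV rtok)) (rpos <~ HAdd (HV re) (HAdd (HGet 0 (HV re)) (HC 1))) (rpos <~ HV re).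

Definition parse_body : hcmd :=
  rtok <~ HGet 0 (HV rpos) ;;
  HIf (HNe (HV rtok) (HC 3))
    (HIf (HNe (HV rtok) (HC 1))
       (option_head ;; link_loop ;; option_tail)
       (decr rpend ;; incr rpos))
    (incr rpend ;; incr rpos).

Definition parse_loop := HWhile (pos (HV rpend)) parse_body.

Definition build : hcmd :=
  (rpos <~ HAdd (HC 3) (HV rn) ;; rq <~ HC 0) ;;
  hfor rq rn (rpend <~ HV rsigma ;; parse_loop).

Lemma half_parity n : n - (n./2 + n./2) = odd n.
Proof. by have := odd_double_half n; lia. Qed.

Arguments code_aapta : simpl never.

Section Program.
Variables (Q Sigma : finType) (Aut : aapta Q Sigma).
Hypothesis nonalt : nonalternating Aut.
Let inp := code_aapta Aut.
Let om := omega Aut.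
Notation code := (@code_state Q).

Definition formulas := [seq delta Aut q sigma | q <- enum Q, sigma <- enum Sigma].

Lemma code_aapta_cat : inp = [:: #|Q|, #|Sigma|, code (init_state Aut) &
  map om (enum Q) ++ codes formulas].
Proof. by rewrite /inp /code_aapta /codes /formulas map_allpairs. Qed.

Lemma formulas_no_and : all (@no_and Q) formulas.
Proof. by apply/all_allpairsP=> q s _ _; apply: nonalternating_no_and. Qed.

Lemma size_inp : size inp = 3 + #|Q| + size (codes formulas).
Proof. by rewrite code_aapta_cat /= size_cat size_map -cardE. Qed.

Lemma drop_formulas : drop (3 + #|Q|) inp = codes formulas.
Proof.
rewrite code_aapta_cat addnC -drop_drop [drop 3 _]/= drop0.
by rewrite drop_size_cat // size_map -cardE.
Qed.

Lemma nth_omega q : nth 0 inp (3 + code q) = om q.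
Proof.
rewrite code_aapta_cat /= nth_cat size_map -cardE code_lt.
exact: nth_enum_code.
Qed.

Lemma measure_input_run st : harr st 0 =1 nth 0 inp ->
  hrun measure_input st (10 * (#|Q| + size inp))
    (fun st' => [/\ hreg st' 1 = size inp, hreg st' rn = #|Q|, hreg st' rsigma = #|Sigma| & hreg st' ri = 0]).
Proof.
move=> inpE.
apply: (hrun_weaken (u := 4 + ((#|Q| * 3 + 1) + (1 + ((10 * size (codes formulas) + 1) + 2))))) (fun=> id);
  last by rewrite size_inp; lia.
apply: hrun_block_seq => //; apply: hrun_seq.
pose I i st := [/\ hreg st rq = i, hreg st rn = #|Q|, hreg st rsigma = #|Sigma|,
  hreg st rpend = i * #|Sigma| & harr st 0 =1 nth 0 inp].
apply: hrun_weaken (hrun_for_cst (u := 2) (I := I) (N := #|Q|) _ _ _) (leqnn _) _.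
- by rewrite /I /= !inpE; split.
- by move=> i st' [].
- move=> i st' _ [e1 e2 e3 e4 e5]; apply: hrun_block => //.
  by rewrite /I /= e1 e2 e3 e4 addn1 mulSn addnC.
move=> {inpE}st [e1 e2 e3 e4 inpE]; apply: hrun_block_seq => //; apply: hrun_seq.
set st1 := hsem _ _.
apply: hrun_weaken (hrun_frame (@skip_loop_run _ inp formulas [::] st1 formulas_no_and _ _ _)) (leqnn _) _.
- by move=> i; rewrite -inpE.
- by rewrite cats0 -drop_formulas -e2.
- by rewrite /= e4 size_allpairs -!cardE.
move=> st2 [epos fV _]; apply: hrun_block => //; split=> //.
- by rewrite size_inp /= epos /= e2.
- by rewrite /= fV //= e2.
- by rewrite /= fV //= e3.
Qed.

Definition static st := [/\ harr st 0 =1 nth 0 inp, hreg st 1 = size inp, hreg st rn = #|Q| &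
  hreg st rsigma = #|Sigma|].

Lemma max_priority_run st : static st -> hrun max_priority st (10 * #|Q| + 3)
  (fun st' => (forall q, om q <= hreg st' rpm) /\ exists q, om q = hreg st' rpm).
Proof.
move=> [inpE e1 en es].
pose I i st := [/\ hreg st rq = i, hreg st rn = #|Q|, harr st 0 =1 nth 0 inp,
  forall q, code q < i -> om q <= hreg st rpm &
  hreg st rpm = 0 \/ exists q, om q = hreg st rpm].
apply: (hrun_weaken (u := 2 + (#|Q| * 5 + 1)) (P := I #|Q|)); last 2 first.
- by lia.
- move=> st' [_ _ _ h1 h2]; have h q : om q <= hreg st' rpm by apply: h1; apply: code_lt.
  split=> //; case: h2 => // z; exists (init_state Aut); have := h (init_state Aut); lia.
apply: hrun_block_seq => //; apply: hrun_for_cst.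
- by split=> //; left.
- by move=> i st' [].
move=> i st' lti [e1' e2 e3 e4 e5]; apply: hrun_block => //.
have [q eq] := code_surj lti.
have ex : harr st' 0 (3 + i) = om q by rewrite e3 -eq nth_omega.
have split_q q' : code q' < i.+1 -> code q' < i \/ q' = q.
  by rewrite ltnS leq_eqVlt => /orP[/eqP|]; [rewrite -eq => /code_inj; right | left].
rewrite /= e1' ex; case: ltnP => lt; split=> //=; rewrite ?e1' ?addn1 //.
- by move=> q' /split_q[/e4 le|->] //; apply: leq_trans le (ltnW lt).
- by right; exists q.
- by move=> q' /split_q[/e4 le|->].
Qed.

Variable pm : nat.
Let beta := odd pm.

Lemma init_arrays_run st : static st -> hreg st rpm = pm ->
  hrun init_arrays st (10 * #|Q| + 3)
  (fun st' => [/\ hreg st' rbeta = beta, forall q, harr st' 7 (code q) = beta &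
     forall q, harr st' 9 (code q) = (odd (om q) != beta)]).
Proof.
move=> [inpE e1 en es] epm.
pose I i st := [/\ hreg st rq = i, hreg st rn = #|Q|, harr st 0 =1 nth 0 inp, hreg st rbeta = beta &
  forall q, code q < i -> harr st 7 (code q) = beta /\ harr st 9 (code q) = (odd (om q) != beta)].
apply: (hrun_weaken (u := 2 + (#|Q| * 6 + 1)) (P := I #|Q|)); last 2 first.
- by lia.
- by move=> st' [_ _ _ h1 h2]; split=> // q; case: (h2 q (code_lt q)).
apply: hrun_block_seq => //; apply: hrun_for_cst.
- by split=> //=; rewrite epm half_parity.
- by move=> i st' [].
move=> i st' lti [e1' e2 e3 e4 e5]; apply: hrun_block => //.
have [q eq] := code_surj lti.
have ex : harr st' 0 (3 + i) = om q by rewrite e3 -eq nth_omega.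
rewrite /= e1' ex half_parity e4.
have -> : (odd (om q) != beta :> nat) = (odd (om q) != beta) by case: (odd _) (beta) => [] [].
case: ifP => ob; split=> //=; rewrite ?e1' ?addn1 // => q' lt'; rewrite -!/(setf _ _ _ _) !setfE -eq;
  rewrite (inj_eq (@code_inj Q)); case: eqVneq => [->|ne]; rewrite ?ob //; apply: e5;
  by move: lt'; rewrite ltnS leq_eqVlt -eq (inj_eq (@code_inj Q)) (negbTE ne).
Qed.

(* Options are listed as (position in the input, (owner, successors)). *)
Implicit Types (P : seq (nat * (Q * seq Q))) (b : nat).

(* The list starting at h threaded through nx, 0 being the end marker; op gives
   its entries. *)
Fixpoint lseg (nx op : nat -> nat) b h l :=
  if l is o :: l' then [/\ 0 < h < b, op h = o & lseg nx op b (nx h) l'] else h = 0.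

Lemma lseg_weaken nx op b b' h l : b <= b' -> lseg nx op b h l -> lseg nx op b' h l.
Proof.
move=> le; elim: l h => //= o l IH h [/andP[h0 hb] eo /IH ?]; split=> //.
by rewrite h0 (leq_trans hb).
Qed.

Lemma lseg_setf nx op b e x y h l : b <= e -> lseg nx op b h l ->
  lseg (setf nx e x) (setf op e y) b h l.
Proof.
move=> le; elim: l h => //= o l IH h [/andP[h0 hb] eo /IH hl].
have /negbTE ne : h != e by rewrite neq_ltn (leq_trans hb).
have neb : Nat.eqb h e = false by apply/PeanoNat.Nat.eqb_neq/eqP; rewrite ne.
by rewrite neb h0 hb.
Qed.

Definition occ P (s : Q) := [seq x.1 | x <- P & s \in x.2.2].

(* Events are successful states when [beta] holds, and dead ones otherwise: an
   option needs all, respectively one, of its successors to have an event, and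
   a state one, respectively all, of its options. A state owning an option
   without successors starts at 0 in the first mode. *)
Definition option_threshold (ss : seq Q) := if beta then size ss else 1.
Definition state_threshold P q : nat :=
  if beta then nat_of_bool (~~ has (fun x => (x.2.1 == q) && nilp x.2.2) P)
  else count (fun x => x.2.1 == q) P.

(** All options and edges created so far lie below [b], which keeps new ones apart from them.
    [built_size] is what makes a round linear: there are no more edges than words read. *)
Record built st P b : Prop := Built {
  built_occ : forall s, lseg (harr st 2) (harr st 3) b (harr st 1 (code s)) (occ P s);
  built_opt : forall x, x \in P -> [/\ x.1 < b, harr st 4 x.1 = code x.2.1,
    harr st 5 x.1 = option_threshold x.2.2 & uniq x.2.2];
  built_sini : forall q, harr st 7 (code q) = state_threshold P q;
  built_uniq : uniq (map fst P);
  built_size : \sum_(x <- P) size x.2.2 <= b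
}.

(** The option being read already counts as a member of the list, with the successors linked so far.
    Since successors are distinct, [o] is entered at most once in the list of each state. *)
Lemma link_loop_run E todo rest done P o q st :
  harr st 0 =1 nth 0 inp ->
  drop (hreg st re) inp = code_elems E todo ++ rest ->
  hreg st rj = size todo -> hreg st ro = o -> uniq (done ++ todo) -> 0 < hreg st re ->
  (forall s, lseg (harr st 2) (harr st 3) (hreg st re) (harr st 1 (code s)) (occ ((o, (q, done)) :: P) s)) ->
  hrun link_loop st (7 * size todo + 1) (fun st' =>
    hreg st' re = hreg st re + (size todo + size todo) /\
    forall s, lseg (harr st' 2) (harr st' 3) (hreg st' re) (harr st' 1 (code s))
      (occ ((o, (q, done ++ todo)) :: P) s)).
Proof.
elim: todo done st => [|s todo IH] done st inpE dr ej eo un e0 hl.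
  apply: hrun_while_false => //=; first by rewrite ej.
  by split=> [|s]; rewrite ?addn0 // cats0.
rewrite [size _]/= mulnS addSn addSn; apply: (hrun_while_true (u1 := 6)).
  by rewrite /= ej.
have [h0 /drop_eq_cons[_ dr2]] := drop_eq_cons dr.
have eS : harr st 0 (hreg st re) = code s by rewrite inpE.
apply: hrun_block => //; set st1 := hsem _ _.
have ere : hreg st1 re = (hreg st re).+2 by rewrite /= addn2.
apply: hrun_weaken (IH (rcons done s) st1 _ _ _ _ _ _ _) (leqnn _) _ => //.
- by rewrite ere.
- by rewrite /= ej subn1.
- by rewrite cat_rcons.
- by rewrite ere.
- move=> s'; rewrite ere.
  have -> : harr st1 1 = setf (harr st 1) (code s) (hreg st re) by rewrite /= eS.
  have -> : harr st1 2 = setf (harr st 2) (hreg st re) (harr st 1 (code s)) by rewrite /= eS.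
  have -> : harr st1 3 = setf (harr st 3) (hreg st re) o by rewrite /= eo.
  rewrite setfE (inj_eq (@code_inj Q)) /occ /= mem_rcons inE.
  have := hl s'; rewrite /occ /=; case: eqVneq => [->|ne] /=.
    have -> /= : (s \in done) = false.
      by move: un; rewrite cat_uniq /= negb_or => /and3P[_ /andP[/negbTE]].
    move=> hs; rewrite !PeanoNat.Nat.eqb_refl; split=> //; first by rewrite e0 ltnS leqnSn.
    by apply: (lseg_weaken (b := hreg st re)); [lia | apply: lseg_setf].
  by case: (s' \in done) => hs; apply: (lseg_weaken (b := hreg st re)); try lia;
    apply: lseg_setf.
move=> st2; rewrite cat_rcons => -[h1 h2]; split=> //; rewrite h1 ere; lia.
Qed.

Definition owned (q : Q) (sss : seq (seq Q)) := [seq (q, ss) | ss <- sss].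

Lemma sini_cons o q ss P q' : state_threshold ((o, (q, ss)) :: P) q' =
  if q == q' then
    if beta then if size ss == 0 then 0 else state_threshold P q' else (state_threshold P q').+1
  else state_threshold P q'.
Proof.
by rewrite /state_threshold /= /nilp; case: (beta); case: eqVneq => //=; case: eqP.
Qed.

Lemma option_run q o ss E rest P st (tk := hreg st rtok) :
  harr st 0 =1 nth 0 inp -> built st P o -> 0 < o ->
  hreg st rq = code q -> hreg st rbeta = beta -> hreg st rpos = o ->
  uniq ss ->
  (if tk is 0 then ss = [::] else
     drop o.+1 inp = size ss :: code_elems E ss ++ rest) ->
  hrun (option_head ;; link_loop ;; option_tail) st (20 + 7 * size ss)
    (fun st' => [/\ built st' ((o, (q, ss)) :: P) (hreg st' rpos),
       hreg st' rpend = hreg st rpend - 1 &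
       hreg st' rpos = if tk is 0 then o.+1 else o + 3 + size ss + size ss + nth 0 rest 0]).
Proof.
move=> inpE bl o0 eq eb epos uss hd.
have ej : (if 0 < tk then harr st 0 (o + 1) else 0) = size ss.
  case: (tk) hd => [->|n] //= /drop_eq_cons[h _]; by rewrite inpE addn1.
apply: (hrun_weaken (u := hlen option_head + ((7 * size ss + 1) + 4))) (fun=> id); last first.
  by rewrite [hlen _]/=; lia.
apply: hrun_block_seq => //; set st1 := hsem option_head st.
have [e1 e2 e3 e4 e5] : [/\ hreg st1 rj = size ss, hreg st1 ro = o, hreg st1 re = (if 0 < tk then o.+2 else o.+1),
    hreg st1 rpend = hreg st rpend - 1 & hreg st1 rtok = tk].
  rewrite /st1 /option_head /= -[hreg st 7]/tk; case: (0 < tk) ej => /= ej.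
    by rewrite eb epos; case: (beta) => /=; rewrite ?ej; try case: (0 < size ss) => /=; rewrite ?ej ?epos ?addn2.
  by rewrite eb epos; case: (beta) => /=; rewrite -?ej ?epos ?addn1.
have [a0 a1 a2 a3] : [/\ harr st1 0 = harr st 0, harr st1 1 = harr st 1, harr st1 2 = harr st 2 & harr st1 3 = harr st 3].
  have [k _ ex] := hexec_loopfree st (erefl : loopfree option_head).
  by have [_ fA] := hexec_frame ex; split; apply: fA.
have a4 : harr st1 4 = setf (harr st 4) o (code q).
  rewrite /st1 /option_head /= -[hreg st 7]/tk; case: (0 < tk) ej => /= ej.
    by rewrite eb epos -eq; case: (beta) => //=; case: ifP.
  by rewrite eb epos -eq; case: (beta).
have a5 : harr st1 5 = setf (harr st 5) o (option_threshold ss).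
  rewrite /st1 /option_head /option_threshold /= -[hreg st 7]/tk; case: (0 < tk) ej => /= ej.
    by rewrite eb epos; case: (beta) => //=; rewrite ?ej; case: ifP => //=; rewrite ?ej.
  by rewrite eb epos -ej; case: (beta).
have enat q' x (f : nat -> nat) : setf f (code q) x (code q') = if q == q' then x else f (code q').
  by rewrite setfE (inj_eq (@code_inj Q)) eq_sym.
have a7 q' : harr st1 7 (code q') = state_threshold ((o, (q, ss)) :: P) q'.
  have -> : harr st1 7 (code q') = 
    if beta then if size ss == 0 then setf (harr st 7) (code q) 0 (code q') else harr st 7 (code q')
    else setf (harr st 7) (code q) (harr st 7 (code q) + 1) (code q').
    rewrite /st1 /option_head /option_threshold /= -[hreg st 7]/tk; case: (0 < tk) ej => /= ej.
      by rewrite eb -eq; case: (beta) => //=; rewrite ?epos ?ej ?lt0n; case: eqP.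
    by rewrite eb -eq -ej; case: (beta).
  rewrite sini_cons !enat !(built_sini bl); case: (eqVneq q q') => [->|_]; last by case: (beta) => //; case: eqP.
  by rewrite addn1.
have [rest' [dr' erest]] : exists rest',
    drop (hreg st1 re) inp = code_elems E ss ++ rest' /\ (0 < tk -> rest' = rest).
  rewrite e3; case: (tk) hd => [->|n /drop_eq_cons[_ h]]; last by exists rest.
  by exists (drop o.+1 inp).
apply: hrun_seq.
apply: hrun_weaken (hrun_frame (@link_loop_run E ss rest' [::] P o q st1 _ dr' e1 e2 uss _ _)) (leqnn _) _.
- by rewrite a0.
- by rewrite e3; case: ifP.
- move=> s; rewrite a1 a2 a3; apply: (lseg_weaken _ (built_occ bl s)).
  by rewrite e3; case: ifP; lia.
move=> st2 [[ere hl] fV fA]; apply: hrun_block => //; set st3 := hsem _ _.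
have Vpend : hreg st3 rpend = hreg st rpend - 1.
  by rewrite /st3 /=; case: ifP => _ /=; rewrite fV.
have A3 a : harr st3 a = harr st2 a by rewrite /st3 /=; case: ifP.
have Vpos : hreg st3 rpos = if 0 < tk then o + 3 + size ss + size ss + nth 0 rest 0 else o.+1.
  have h : nth 0 inp (hreg st2 re) = nth 0 rest' 0.
    by rewrite ere -nth_drop dr' nth_cat size_code_elems ltnn subnn.
  rewrite /st3 /= fV // e5; case: ifP erest => /= t0 erest.
    by rewrite fA // a0 inpE h erest // ere e3 t0; lia.
  move: hd; rewrite ere e3 t0; case: (tk) t0 => // _ ->; rewrite addn0 //.
have leb : o <= hreg st3 rpos by rewrite Vpos; case: ifP; lia.
split=> //; last by rewrite Vpos; case: (tk).
split.
- move=> s; rewrite !A3; apply: lseg_weaken (hl s).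
  rewrite Vpos ere e3; case t0: (0 < tk); first by move: (size ss) (nth 0 rest 0); clear; lia. 
  by move: hd; case: (tk) t0 => // _ ->; rewrite addn0.
- move=> x; rewrite inE => /orP[/eqP->|xP] /=.
    rewrite !A3 !fA // a4 a5 !setfE eqxx; split=> //; rewrite Vpos; case: ifP; lia.
  have [h1 h2 h3 h4] := built_opt bl xP.
  rewrite !A3 !fA // a4 a5 !setfE; case: eqVneq => [e|_]; first by rewrite e ltnn in h1.
  by split=> //; apply: leq_trans leb.
- by move=> q'; rewrite A3 fA.
- rewrite /= (built_uniq bl) andbT; apply/negP => /mapP[x /(built_opt bl)[+ _ _ _] e].
  by rewrite -e ltnn.
- rewrite big_cons /= Vpos; have := built_size bl; move: (\sum_(x <- P) _) => k.
  case t0: (0 < tk); first by move: (size ss) (nth 0 rest 0); clear; lia.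
  by move: hd; case: (tk) t0 => // _ -> /= h; rewrite add0n leqW.
Qed.

Lemma built_weaken st st' P b b' :
  built st P b -> (forall a, 0 < a < 8 -> a != 6 -> harr st' a = harr st a) -> b <= b' -> built st' P b'.
Proof.
move=> bl eA le; split=> [s|x /(built_opt bl)[h1 h2 h3 h4]|q||].
- by rewrite !eA //; apply: lseg_weaken le (built_occ bl s).
- by rewrite !eA //; split=> //; apply: leq_trans le.
- by rewrite eA // (built_sini bl).
- exact: built_uniq bl.
- exact: leq_trans (built_size bl) le.
Qed.

(** The same induction on the code as for [skip_loop_run]. New options are put in front of [P],
    whence the reversal. *)
Lemma parse_loop_run q phis rest P st :
  all (@no_and Q) phis -> harr st 0 =1 nth 0 inp ->
  drop (hreg st rpos) inp = codes phis ++ rest -> hreg st rpend = size phis ->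
  hreg st rq = code q -> hreg st rbeta = beta -> 0 < hreg st rpos -> built st P (hreg st rpos) ->
  hrun parse_loop st (30 * size (codes phis) + 1) (fun st' => exists P',
    [/\ built st' P' (hreg st' rpos),
      map snd P' = rev (owned q (flatten (map (@options Q) phis))) ++ map snd P &
      hreg st' rpos = hreg st rpos + size (codes phis)]).
Proof.
have [m] := ubnP (size (codes phis)); elim: m => // m IH in phis rest P st *.
case: phis => [|phi phis] ltm.
  move=> _ _ _ e _ _ _ bl; apply: hrun_while_false => //=; first by rewrite e.
  by exists P; rewrite addn0.
move=> nand inpE dr epend eq eb p0 bl.
have next cs psis sss : hrun parse_body st (29 * size cs) (fun st' => exists P1,
      [/\ built st' P1 (hreg st' rpos), map snd P1 = rev (owned q sss) ++ map snd P,
        hreg st' rpos = hreg st rpos + size cs & hreg st' rpend = size psis]) ->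
    size cs > 0 -> codes (phi :: phis) = cs ++ codes psis -> all (@no_and Q) psis ->
    options phi ++ flatten (map (@options Q) phis) = sss ++ flatten (map (@options Q) psis) ->
    hrun parse_loop st (30 * size (codes (phi :: phis)) + 1) (fun st' => exists P',
    [/\ built st' P' (hreg st' rpos),
      map snd P' = rev (owned q (flatten (map (@options Q) (phi :: phis)))) ++ map snd P &
      hreg st' rpos = hreg st rpos + size (codes (phi :: phis))]).
  move=> run c0 ecs npsis eo; rewrite ecs in ltm dr *; rewrite size_cat in ltm *.
  apply: (hrun_weaken (u := (29 * size cs + (30 * size (codes psis) + 1)).+1)) (fun=> id);
    last by move: c0; clear; lia.
  apply: hrun_while_true; first by rewrite /= epend.
  apply: hrun_weaken (hrun_frame run) (leqnn _) _ => st' [[P1 [bl1 eP1 epos epend']] fV fA].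
  apply: hrun_weaken (IH psis rest P1 st' _ npsis _ _ epend' _ _ _ bl1) (leqnn _) _.
  - by move: ltm c0; clear; lia.
  - by rewrite fA.
  - by rewrite epos; apply: drop_append; rewrite catA.
  - by rewrite fV.
  - by rewrite fV.
  - by rewrite epos ltn_addr.
  - move=> st2 [P' [bl' eP' epos']]; exists P'; split=> //; last by rewrite epos' epos addnA.
    by rewrite eP' eP1 catA -rev_cat -map_cat -eo.
have bl0 k : built (setV st rtok k) P (hreg st rpos) by apply: built_weaken bl _ _.
case: phi => [||p|a b|a b] in ltm nand dr epend next *.
- apply: (next [:: 0] phis [:: [::]]) => //.
  have [h0 _] := drop_eq_cons dr.
  apply: hrun_block_seq => //; apply: hrun_if; rewrite /= inpE h0 /=; apply: hrun_if => /=.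
  apply: hrun_weaken (@option_run q (hreg st rpos) [::] [ffun=> 0] [::] P _ _ _ _ _ _ _ _ _) _ _ => //=.
  move=> st' [bl' epend' epos']; exists ((hreg st rpos, (q, [::])) :: P).
  by split=> //=; rewrite ?epos' ?epend' ?epend ?addn1 //= subn1.
- apply: (next [:: 1] phis [::]) => //.
  have [h0 _] := drop_eq_cons dr.
  apply: (hrun_weaken (u := 1 + 4)) (fun=> id) => //.
  apply: hrun_block_seq => //; apply: hrun_if; rewrite /= inpE h0 /=; apply: hrun_if => /=.
  apply: (@hrun_block _ _ 2) => //=; exists P; rewrite epend /= subn1.
  by split=> //; apply: built_weaken bl _ _ => //; rewrite addn1.
- apply: (next (code_constr (EUatom p)) phis [:: enum (msupp (eu_E p))]) => //.
  rewrite -[codes _]/(code_constr (EUatom p) ++ codes phis) -catA code_atom_cat in dr.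
  have [h0 dr1] := drop_eq_cons dr.
  set ss := enum _ in dr dr1 *; set r := #|eu_U p| :: _ in dr1.
  have ess : size ss = #|msupp (eu_E p)| by rewrite -cardE.
  rewrite -ess in dr1.
  apply: (hrun_weaken (u := 1 + (20 + 7 * size ss).+2)) (fun=> id);
    last by rewrite size_code_atom -ess; clear; lia.
  rewrite size_code_atom -ess.
  apply: hrun_block_seq => //; apply: hrun_if; rewrite /= inpE h0 /=; apply: hrun_if => /=.
  apply: hrun_weaken (@option_run q (hreg st rpos) ss (eu_E p) r P _ _ _ _ _ _ _ _ _) _ _ => //.
    exact: enum_uniq.
  move=> st' [bl' epend' epos']; exists ((hreg st rpos, (q, ss)) :: P).
  rewrite /= in epend' epos'.
  split=> //; last by rewrite epend' epend /= subn1.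
  by rewrite epos'; clear; lia.
- by [].
- apply: (next [:: 3] [:: a, b & phis] [::]) => //.
  + have [h0 _] := drop_eq_cons dr.
    apply: (hrun_weaken (u := 1 + 3)) (fun=> id) => //.
    apply: hrun_block_seq => //; apply: hrun_if; rewrite /= inpE h0 /=.
    apply: (@hrun_block _ _ 2) => //=; exists P; rewrite epend /= addn1.
    by split=> //; apply: built_weaken bl _ _ => //; rewrite addn1.
  + by rewrite /codes /= -catA.
  + by move: nand; rewrite /= andbA.
  + by rewrite /= catA.
Qed.

Definition formulas_of q := [seq delta Aut q sigma | sigma <- enum Sigma].
Definition all_options : seq (Q * seq Q) :=
  flatten [seq owned q (flatten (map (@options Q) (formulas_of q))) | q <- enum Q].

Lemma has_all_options (a : pred (seq Q)) q :
  has (fun y => (y.1 == q) && a y.2) all_options = [exists sigma, has a (options (delta Aut q sigma))].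
Proof.
apply/hasP/existsP => [[[q' ss] /flattenP[_ /mapP[q1 _ ->] /mapP[ss' hs [-> ->]]] /andP[/eqP/= eq h]]|].
  move: hs; rewrite -map_comp => /flattenP[_ /mapP[sigma _ ->] hs].
  by exists sigma; apply/hasP; exists ss'; rewrite -?eq.
case=> sigma /hasP[ss hs h]; exists (q, ss); last by rewrite eqxx.
apply/flattenP; exists (owned q (flatten (map (@options Q) (formulas_of q)))).
  by apply: map_f; rewrite mem_enum.
apply: map_f; apply/flattenP; exists (options (delta Aut q sigma)) => //.
by rewrite -map_comp; apply/mapP; exists sigma; rewrite ?mem_enum.
Qed.

Lemma codes_cat (s t : seq (eu_constr Q)) : codes (s ++ t) = codes s ++ codes t.
Proof. by rewrite /codes map_cat flatten_cat. Qed.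

Lemma size_codes_flatten (s : seq Q) :
  size (codes (flatten (map formulas_of s))) = \sum_(q <- s) size (codes (formulas_of q)).
Proof.
by elim: s => [|q s IH]; rewrite ?big_nil // big_cons /= codes_cat size_cat IH.
Qed.

Lemma build_run st : static st -> hreg st rbeta = beta ->
  (forall q, harr st 1 (code q) = 0) -> (forall q, harr st 7 (code q) = beta) ->
  hrun build st (30 * size inp + 10 * #|Q|) (fun st' => exists P,
    built st' P (size inp) /\ map snd P = rev all_options).
Proof.
move=> [inpE eL en es] eb hA1 hA7.
pose q0 := init_state Aut.
(* The cost of a state depends on its own formulas; only the sum over all states is linear in the
   input. *)
pose u i := 3 + 30 * size (codes (formulas_of (nth q0 (enum Q) i))).
pose I i st := [/\ [/\ hreg st rq = i, hreg st rn = #|Q|, hreg st rsigma = #|Sigma|, hreg st rbeta = beta &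
  harr st 0 =1 nth 0 inp], 0 < hreg st rpos,
  hreg st rpos + size (codes (flatten (map formulas_of (drop i (enum Q))))) = size inp,
  drop (hreg st rpos) inp = codes (flatten (map formulas_of (drop i (enum Q)))) &
  exists P, built st P (hreg st rpos) /\ map snd P =
    rev (flatten [seq owned q (flatten (map (@options Q) (formulas_of q))) | q <- take i (enum Q)])].
apply: (hrun_weaken (u := 2 + ((\sum_(0 <= i < #|Q|) (u i).+1) + 1)) (P := I #|Q|)); first last.
- move=> st' [_ _ epos _ [P [bl eP]]]; exists P; split.
    by apply: built_weaken bl _ _ => //; rewrite -epos leq_addr.
  by rewrite eP cardE take_size.
- have -> : \sum_(0 <= i < #|Q|) (u i).+1 = 30 * size (codes formulas) + 4 * #|Q|.
    transitivity (\sum_(q <- enum Q) (4 + 30 * size (codes (formulas_of q)))).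
      by rewrite [RHS](big_nth q0) -cardE; apply: eq_bigr => i _; rewrite /u.
    rewrite big_split /= big_const_seq count_predT iter_addn_0 -cardE -big_distrr /= -size_codes_flatten.
    by rewrite addnC mulnC -/formulas.
  by rewrite size_inp; move: (size _) => k; have := ltn_ord (enum_rank q0); clear; lia.
apply: hrun_block_seq => //; apply: hrun_for => //.
- split.
  + by split.
  + by [].
  + by rewrite drop0 -/formulas size_inp -en.
  + by rewrite drop0 -[RHS]drop_formulas -en.
  + exists [::]; rewrite take0; split=> //; split=> //=.
    by rewrite big_nil.
- by move=> i st' [[]].
move=> i st1 lti [[e1 e2 e3 e4 inpE1] p0 epos dr [P [bl eP]]].
have dri : drop i (enum Q) = nth q0 (enum Q) i :: drop i.+1 (enum Q).
  by rewrite (drop_nth q0) // -cardE.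
have tki : take i.+1 (enum Q) = rcons (take i (enum Q)) (nth q0 (enum Q) i).
  by rewrite (take_nth q0) // -cardE.
have cq : code (nth q0 (enum Q) i) = i.
  by have [q' <-] := code_surj lti; rewrite /code_state nth_enum_rank.
have fl : flatten (map formulas_of (drop i (enum Q))) =
    formulas_of (nth q0 (enum Q) i) ++ flatten (map formulas_of (drop i.+1 (enum Q))).
  by rewrite dri.
rewrite fl codes_cat in dr epos; rewrite size_cat in epos.
rewrite /u; set q := nth q0 _ _ in cq dr epos tki fl *.
apply: (hrun_weaken (u := (1 + (30 * size (codes (formulas_of q)) + 1)) + 1)) (fun=> id);
  last by clear; lia.
apply: hrun_seq; apply: hrun_block_seq => //; set st2 := hsem _ _.
have nf : all (@no_and Q) (formulas_of q).
  by rewrite /formulas_of all_map; apply/allP => sigma _; apply: nonalternating_no_and.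
have bl2 : built st2 P (hreg st2 rpos) by apply: built_weaken bl _ _.
have ep : hreg st2 rpend = size (formulas_of q) by rewrite /= e3 size_map -cardE.
apply: hrun_weaken (hrun_frame (@parse_loop_run q _ _ P st2 nf inpE1 dr ep _ e4 p0 bl2)) (leqnn _) _.
  by rewrite /= e1.
move=> st3 [[P' [bl' eP' epos']] fV fA]; apply: hrun_block => //; split.
- split; rewrite /= ?fV //= ?e1 ?addn1 //.
  by move=> j; rewrite fA //; apply: inpE1.
- by rewrite /= epos' ltn_addr.
- by rewrite /= epos' -addnA.
- by rewrite /= epos'; apply: drop_append.
- exists P'; split; first by apply: built_weaken bl' _ _.
  by rewrite eP' eP tki map_rcons -cats1 flatten_cat /= cats0 rev_cat.
Qed.

End Program.

(** * One round: saturation with counters *)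

Definition reset_counters : hcmd :=
  ri <~ HC 0 ;; hfor ri 1 (HPut 6 (HV ri) (HGet 5 (HV ri))).

(** The lower levels are fixed during a round, so their members according to array 9 are events from
    the start, whereas a state of the largest priority starts as an event only if its counter is
    already 0. *)
Definition seed_body : hcmd :=
  HPut 8 (HV rq) (HGet 7 (HV rq)) ;;
  rx <~ HGet 0 (HAdd (HC 3) (HV rq)) ;;
  HIf (HNe (HV rx) (HV rpm)) (ry <~ HGet 9 (HV rq))
    (HIf (pos (HGet 7 (HV rq))) (ry <~ HC 0) (ry <~ HC 1)) ;;
  HIf (pos (HV ry)) (HPut 10 (HV rsp) (HV rq) ;; incr rsp) skip.

Definition seed : hcmd := (rsp <~ HC 0 ;; rq <~ HC 0) ;; hfor rq rn seed_body.

(** Array 8 is maintained for every state, but only states of the largest priority are pushed: the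
    counters of the others give, at the end of the round, the value to be compared with their
    assignment. *)
Definition touch_state : hcmd :=
  rq <~ HGet 4 (HV ro) ;;
  ry <~ HGet 8 (HV rq) ;;
  HPut 8 (HV rq) (HSub (HV ry) (HC 1)) ;;
  HIf (HNe (HV ry) (HC 1)) skip
    (HIf (HNe (HGet 0 (HAdd (HC 3) (HV rq))) (HV rpm)) skip
      (HPut 10 (HV rsp) (HV rq) ;; incr rsp)).

(** The owner is notified only by the decrement that takes the counter of the option from 1 to 0;
    truncated subtraction keeps it at 0 afterwards. *)
Definition touch_body : hcmd :=
  (ro <~ HGet 3 (HV re) ;; rx <~ HGet 6 (HV ro)) ;;
  HIf (HNe (HV rx) (HC 1)) skip touch_state ;;
  (HPut 6 (HV ro) (HSub (HV rx) (HC 1)) ;; re <~ HGet 2 (HV re)).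

Definition touch_loop := HWhile (pos (HV re)) touch_body.

Definition saturate : hcmd :=
  HWhile (pos (HV rsp))
    ((decr rsp ;; rs <~ HGet 10 (HV rsp) ;; re <~ HGet 1 (HV rs)) ;; touch_loop).

Definition evaluate : hcmd := reset_counters ;; seed ;; saturate.

Section Evaluate.
Variables (Q Sigma : finType) (Aut : aapta Q Sigma).
Let inp := code_aapta Aut.
Let om := omega Aut.
Let q0 := init_state Aut.
Notation code := (@code_state Q).
Variable pm : nat.
Let beta := odd pm.
Variable P : seq (nat * (Q * seq Q)).
Hypotheses (uniqP : uniq (map fst P)) (uniq_succ : forall x, x \in P -> uniq x.2.2)
  (sndP : map snd P = rev (all_options Aut)).
Implicit Types (Y Z X : {set Q}) (D : seq nat) (Pr Stk : seq Q).
Notation cini := (option_threshold pm).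
Notation sini := (state_threshold pm P).

(* When the largest priority is even the game is solved for the opponent, so
   that the innermost fixpoint is always a least one. *)
Definition mode_pre Z : {set Q} := if beta then cpre Aut Z else dual (cpre Aut) Z.
Definition mode_least p := odd p == beta.

Lemma mode_pre_mono : mono mode_pre.
Proof. by rewrite /mode_pre; case: (beta); [exact: cpre_mono | exact: dual_mono (@cpre_mono _ _ _)]. Qed.

(** An option without successors has threshold 0 in the first mode and is never completed by a
    decrement, so it is excluded here; [state_threshold] accounts for it. *)
Definition fires Z (x : nat * (Q * seq Q)) := 0 < cini x.2.2 <= count [in Z] x.2.2.
Definition nfires Z q := count (fun x => (x.2.1 == q) && fires Z x) P.

Lemma has_options (a : pred (seq Q)) q : has (fun x => (x.2.1 == q) && a x.2.2) P =
  [exists sigma, has a (options (delta Aut q sigma))].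
Proof.
by rewrite -has_all_options -[RHS]has_rev -sndP has_map; apply: eq_has.
Qed.

Lemma count_leq_sub (T : eqType) (a b : pred T) s :
  (count a s <= count (fun x => a x && b x) s) = all (fun x => a x ==> b x) s.
Proof.
elim: s => //= x s IH; case: (a x) => /=; last by rewrite add0n IH.
have le : count (fun x => a x && b x) s <= count a s by apply: sub_count => y /andP[].
case: (b x) => /=; first by rewrite -IH; lia.
by apply/negbTE; rewrite -ltnNge; lia.
Qed.

(** The counter form of one step, as for Horn clauses. When [beta] holds, one option must have all
    its successors in [Z], and an empty option lowers the threshold to 0; otherwise every option
    must have a successor in [Z], so the firing options must reach their total number. *)
Lemma mode_preE Z q : (q \in mode_pre Z) = (sini q <= nfires Z q).
Proof.
rewrite /mode_pre /nfires /fires /state_threshold /option_threshold -/beta; case: (beta).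
  rewrite inE -has_options; case hn: (has (fun x => (x.2.1 == q) && nilp x.2.2) P) => /=.
    rewrite leq0n; apply/hasP; case/hasP: hn => x xP /andP[xq /nilP e].
    by exists x; rewrite ?xq ?e.
  rewrite -has_count; apply: eq_in_has => x xP; case: eqP => //= e.
  have nn : ~~ nilp x.2.2.
    by apply/negP=> n; move/negbT/hasPn: hn => /(_ x xP); rewrite e eqxx n.
  by rewrite lt0n nn all_count eqn_leq count_size.
rewrite /dual !inE -has_options count_leq_sub -all_predC; apply: eq_all => x /=.
rewrite negb_and; case: eqP => //= _; rewrite -has_count.
rewrite -has_predC; apply: eq_has => s /=.
by rewrite inE negbK.
Qed.

Definition fired D (x : nat * (Q * seq Q)) := 0 < cini x.2.2 <= count_mem x.1 D.
Definition nfired D q := count (fun x => (x.2.1 == q) && fired D x) P.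

Lemma option_inj x y : x \in P -> y \in P -> x.1 = y.1 -> x = y.
Proof.
move=> xP yP e; have h z : z \in P -> nth x P (index z.1 (map fst P)) = z.
  move=> zP; have lt : index z P < size P by rewrite index_mem.
  rewrite -[in z.1](nth_index x zP) -(nth_map x x.1) //.
  by rewrite index_uniq ?size_map // nth_index.
by rewrite -(h x xP) -(h y yP) e.
Qed.

(** Only the decrement that meets the threshold of [x] raises the count, and only for the owner of
    [x]: this matches the test for 1 in [touch_body]. *)
Lemma nfired_cons x D q : x \in P ->
  nfired (x.1 :: D) q = nfired D q + ((x.2.1 == q) && (cini x.2.2 == (count_mem x.1 D).+1)).
Proof.
move=> xP; pose b := (x.2.1 == q) && (cini x.2.2 == (count_mem x.1 D).+1).
have e y : y \in P -> (y.2.1 == q) && fired (x.1 :: D) y =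
    ((y.2.1 == q) && fired D y) || ((y == x) && b).
  move=> yP; rewrite /fired /=; case: (eqVneq y x) => [->|ne] /=.
    rewrite eqxx /= /b; case: (x.2.1 == q) => //=; move: (cini _) (count_mem _ _) => c d; lia.
  have /negbTE -> : x.1 != y.1 by apply: contra ne => /eqP h; rewrite (option_inj xP yP h).
  by rewrite add0n orbF.
rewrite /nfired (eq_in_count e) -/b; case eb: b; last first.
  by rewrite addn0; apply: eq_in_count => y _; rewrite andbF orbF.
have h := count_predUI (fun y => (y.2.1 == q) && fired D y) (pred1 x) P.
rewrite (count_uniq_mem _ (map_uniq uniqP)) xP in h; rewrite -h.
rewrite [X in _ = _ + X](_ : _ = 0).
  by rewrite addn0; apply: eq_count => y /=; rewrite andbT.
rewrite -(count_pred0 P); apply: eq_in_count => y _ /=; case: (eqVneq y x) => [->|]; last by rewrite andbF.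
by apply/negbTE; move: eb; rewrite /b /fired => /andP[-> /eqP->]; rewrite ltnn !andbF.
Qed.

Lemma nfired_leq D q Z : (forall x, x \in P -> count_mem x.1 D <= count [in Z] x.2.2) ->
  nfired D q <= nfires Z q.
Proof.
move=> le; rewrite /nfired /nfires -!size_filter.
rewrite !size_filter; have : {in P, forall x, ((x.2.1 == q) && fired D x) ==> ((x.2.1 == q) && fires Z x)}.
  move=> x xP; rewrite /fired /fires; case: (x.2.1 == q) => //=.
  by apply/implyP=> /andP[-> h]; apply: leq_trans (le x xP).
elim: P => //= x s IH h; apply: leq_add.
  by have := h x (mem_head _ _); do 2 case: (_ && _).
by apply: IH => y ys; apply: h; rewrite inE ys orbT.
Qed.

Variables (Y X : {set Q}).
Hypothesis X_closed : forall q, om q = pm -> q \in mode_pre X -> q \in X.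

(* D is the trace of the options whose counter has been decremented, Pr the
   processed states, Stk the worklist; Y fixes the levels below pm and X is the
   fixpoint being approached from below. *)
Record inv st D Pr Stk : Prop := Inv {
  inv_opt : forall x, x \in P -> harr st 6 x.1 = cini x.2.2 - count_mem x.1 D;
  inv_state : forall q, harr st 8 (code q) = sini q - nfired D q;
  inv_sp : hreg st rsp = size Stk;
  inv_stk : forall i, i < size Stk -> harr st 10 i = code (nth q0 Stk i);
  inv_uniq : uniq (Pr ++ Stk);
  inv_mem : forall q, (q \in Pr ++ Stk) =
    if om q == pm then harr st 8 (code q) == 0 else q \in Y;
  inv_sub : {subset Pr ++ Stk <= X}
}.

Definition ready st := [/\ harr st 0 =1 nth 0 inp, hreg st 1 = size inp, hreg st rn = #|Q|,
  hreg st rpm = pm & hreg st rbeta = beta] /\ built pm st P (size inp).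

Lemma ready_frame c st st' :
  (forall r, wrV c r = false -> hreg st' r = hreg st r) ->
  (forall a, wrA c a = false -> harr st' a = harr st a) ->
  [&& ~~ wrV c 1, ~~ wrV c rn, ~~ wrV c rpm, ~~ wrV c rbeta &
     all (fun a => ~~ wrA c a) [:: 0; 1; 2; 3; 4; 5; 7]] ->
  ready st -> ready st'.
Proof.
move=> fV fA /and5P[/negbTE h1 /negbTE h2 /negbTE h3 /negbTE h4 /allP hA] [[e0 e1 e2 e3 e4] bl].
have eA a : a \in [:: 0; 1; 2; 3; 4; 5; 7] -> harr st' a = harr st a by move=> /hA /negbTE /fA.
split; first by rewrite !fV // eA.
by apply: built_weaken bl _ _ => // -[|[|[|[|[|[|[|[|a]]]]]]]] // _ _; apply: eA.
Qed.

(** This carries the soundness of saturation. When the owner is pushed, its counter reaches 0, so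
    enough options have fired; the decrements are bounded by the numbers of successors in [X], hence
    these options fire for [X] as well, and closure of [X] puts the owner into it. *)
Lemma touch_body_sem st x D Pr Stk (st' := hsem touch_body st) :
  ready st -> x \in P -> harr st 3 (hreg st re) = x.1 -> inv st D Pr Stk ->
  (forall y, y \in P -> count_mem y.1 (x.1 :: D) <= count [in X] y.2.2) ->
  hreg st' re = harr st 2 (hreg st re) /\ exists Stk', inv st' (x.1 :: D) Pr Stk'.
Proof.
move=> [[inpE e1 en epm eb] bl] xP eo iv le.
have [xlt own_x _ _] := built_opt bl xP.
pose q := x.2.1; pose c := count_mem x.1 D.
have E6 : harr st 6 x.1 = cini x.2.2 - c := inv_opt iv xP.
have E6' v y : y \in P -> setf (harr st 6) x.1 v y.1 = if y == x then v else harr st 6 y.1.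
  move=> yP; rewrite setfE; case: (eqVneq y x) => [->|ne]; first by rewrite eqxx.
  by have /negbTE -> : y.1 != x.1 by apply: contra ne => /eqP h; rewrite (option_inj yP xP h).
have opt' y : y \in P ->
    (if y == x then harr st 6 x.1 - 1 else harr st 6 y.1) = cini y.2.2 - count_mem y.1 (x.1 :: D).
  move=> yP; rewrite /= (inv_opt iv yP) (inv_opt iv xP) eq_sym; case: eqVneq => [->|ne].
    by rewrite eqxx -subnDA [true + _]addnC.
  by have /negbTE -> : x.1 != y.1 by apply: contra ne => /eqP h; rewrite (option_inj xP yP h).
have nf q' := nfired_cons D q' xP.
case r1: (harr st 6 x.1 == 1); last first.
  have -> : st' = setV (setA (setV (setV (setV st ro x.1) rx (harr st 6 x.1)) 19 0) 6 x.1 (harr st 6 x.1 - 1)) re (harr st 2 (hreg st re)).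
    by rewrite /st' /= eo r1.
  split=> //; exists Stk; split.
  - by move=> y yP; rewrite -opt' // -E6'.
  - move=> q'; rewrite nf -/c (_ : (cini x.2.2 == c.+1) = false) ?andbF ?addn0; first exact: inv_state iv q'.
    by move/eqP: r1; rewrite E6; move: (cini _) => ci; clear; lia.
  - exact: inv_sp iv.
  - exact: inv_stk iv.
  - exact: inv_uniq iv.
  - exact: inv_mem iv.
  - exact: inv_sub iv.
have ec : cini x.2.2 = c.+1 by move/eqP: r1; rewrite E6; move: (cini _) => ci; clear; lia.
pose v := harr st 8 (code q); have nested_fix : v = sini q - nfired D q := inv_state iv q.
have st8 q' : setf (harr st 8) (code q) (v - 1) (code q') = sini q' - nfired (x.1 :: D) q'.
  rewrite setfE (inj_eq (@code_inj Q)) nf -/c ec eqxx andbT -/q [q == q']eq_sym.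
  by case: (eqVneq q' q) => [->|_]; [rewrite nested_fix -subnDA | rewrite addn0 (inv_state iv)].
have zero q' : (setf (harr st 8) (code q) (v - 1) (code q') == 0) =
    (harr st 8 (code q') == 0) || ((q' == q) && (v == 1)).
  rewrite setfE (inj_eq (@code_inj Q)); case: (eqVneq q' q) => [->|_]; last by rewrite orbF.
  by rewrite -/v; clear; move: v => [|[|v]].
have eom : harr st 0 (3 + code q) = om q by rewrite inpE nth_omega.
case pu: ((v == 1) && (om q == pm)); last first.
  have [h6 h8 h10 hsp hre] : [/\ harr st' 6 = setf (harr st 6) x.1 (harr st 6 x.1 - 1),
      harr st' 8 = setf (harr st 8) (code q) (v - 1), harr st' 10 = harr st 10, hreg st' rsp = hreg st rsp & hreg st' re = harr st 2 (hreg st re)].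
    rewrite /st' /touch_body /touch_state /= eo r1 /= own_x -/q -/v eom epm; move: pu.
    by case: (v == 1) => //=; case: (om q == pm).
  split=> //; exists Stk; split.
  - by move=> y yP; rewrite -opt' // h6 E6'.
  - by move=> q'; rewrite h8 st8.
  - by rewrite hsp; exact: inv_sp iv.
  - by rewrite h10; exact: inv_stk iv.
  - exact: inv_uniq iv.
  - move=> q'; rewrite h8 zero (inv_mem iv); case: ifP => // /eqP e.
    case: (eqVneq q' q) pu => [eq|_]; last by rewrite orbF.
    by rewrite -eq e eqxx andbT => ->; rewrite orbF.
  - exact: inv_sub iv.
case/andP: pu => /eqP v1 /eqP omq.
have [h6 h8 h10 hsp hre] : [/\ harr st' 6 = setf (harr st 6) x.1 (harr st 6 x.1 - 1),
    harr st' 8 = setf (harr st 8) (code q) (v - 1), harr st' 10 = setf (harr st 10) (hreg st rsp) (code q),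
    hreg st' rsp = (hreg st rsp).+1 & hreg st' re = harr st 2 (hreg st re)].
  by rewrite /st' /touch_body /touch_state /= eo r1 /= own_x -/q -/v eom epm v1 omq !eqxx /= addn1.
have qnew : q \notin Pr ++ Stk by rewrite (inv_mem iv) omq eqxx -/v v1.
split=> //; exists (rcons Stk q); split.
- by move=> y yP; rewrite -opt' // h6 E6'.
- by move=> q'; rewrite h8 st8.
- by rewrite hsp size_rcons (inv_sp iv).
- move=> i; rewrite size_rcons ltnS h10 setfE nth_rcons (inv_sp iv).
  rewrite leq_eqVlt => /orP[/eqP->|lt]; first by rewrite !eqxx ltnn.
  by rewrite lt ltn_eqF // (inv_stk iv).
- by rewrite -rcons_cat rcons_uniq qnew (inv_uniq iv).
- move=> q'; rewrite -rcons_cat mem_rcons inE h8 zero (inv_mem iv) v1 andbT.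
  by case: (eqVneq q' q) => [->|_]; rewrite ?omq ?eqxx ?orbT // orbF.
- move=> q'; rewrite -rcons_cat mem_rcons inE => /orP[/eqP->|/(inv_sub iv)//].
  apply: X_closed => //; rewrite mode_preE.
  apply: leq_trans (nfired_leq q le).
  rewrite -subn_eq0 -st8 zero eqxx v1 orbT //.
Qed.

Lemma touch_loop_run l st D Pr Stk :
  ready st -> lseg (harr st 2) (harr st 3) (size inp) (hreg st re) l ->
  {subset l <= map fst P} -> inv st D Pr Stk ->
  (forall y, y \in P -> count_mem y.1 (l ++ D) <= count [in X] y.2.2) ->
  hrun touch_loop st (15 * size l + 1) (fun st' => exists Stk', inv st' (catrev l D) Pr Stk').
Proof.
elim: l st D Stk => [|o l IH] st D Stk rd /=.
  move=> e0 _ iv _; apply: hrun_while_false => //=; first by rewrite e0.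
  by exists Stk.
case=> /andP[h0 _] eo hl sub iv le.
have /mapP[x xP ex] : o \in map fst P by apply: sub; rewrite mem_head.
rewrite ex in eo le *.
rewrite mulnS addSn addSn; apply: (hrun_while_true (u1 := 14)) => //.
apply: hrun_weaken (hrun_frame (@hrun_block touch_body st 14 (fun st' => st' = hsem touch_body st) _ _ _))
  (leqnn _) _ => // st' [est' fV fA].
have [|hre [Stk' iv']] := touch_body_sem rd xP eo iv.
  move=> y yP; apply: leq_trans (le y yP); rewrite /= leq_add2l count_cat.
  by rewrite leq_addl.
rewrite -est' in hre iv'.
apply: IH iv' _; first by apply: (ready_frame fV fA _ rd).
- by rewrite hre !fA.
- by move=> o' ol; apply: sub; rewrite inE ol orbT.
- move=> y yP; apply: leq_trans (le y yP).
  by rewrite /= !count_cat /= addnCA.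
Qed.

Lemma count_occ x s : x \in P -> count_mem x.1 (occ P s) = (s \in x.2.2).
Proof.
move=> xP; rewrite count_uniq_mem; last first.
  by apply: subseq_uniq uniqP; apply: map_subseq; apply: filter_subseq.
congr nat_of_bool; apply/mapP/idP => [[y]|sx]; last by exists x; rewrite ?mem_filter ?sx.
by rewrite mem_filter => /andP[sy yP] /(option_inj xP yP)->.
Qed.

Lemma count_in_cons (s : Q) Pr ss : uniq ss -> s \notin Pr ->
  count [in s :: Pr] ss = (s \in ss) + count [in Pr] ss.
Proof.
move=> us /negbTE sPr; rewrite -(count_uniq_mem _ us) -count_predUI [X in _ + X](_ : _ = 0).
  by rewrite addn0; apply: eq_count => y; rewrite /= inE.
rewrite -(count_pred0 ss); apply: eq_count => y /=.
by case: (eqVneq y s) => [->|//]; rewrite sPr.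
Qed.

(** A potential: the cost that the states not yet processed can still cause, each being processed at
    most once. *)
Definition saturate_cost Pr := \sum_(s | s \notin Pr) (6 + 15 * size (occ P s)).

(** Between two pops the trace [D] counts exactly the processed successors of each option. A popped
    state joins [Pr] before its list is traversed, and the traversal restores the equality. *)
Lemma saturate_run k st D Pr Stk :
  ready st -> inv st D Pr Stk ->
  (forall x, x \in P -> count_mem x.1 D = count [in Pr] x.2.2) ->
  saturate_cost Pr <= k ->
  hrun saturate st (k + 1) (fun st' => exists D' Pr', inv st' D' Pr' [::] /\
    forall x, x \in P -> count_mem x.1 D' = count [in Pr'] x.2.2).
Proof.
elim/ltn_ind: k st D Pr Stk => k IH st D Pr Stk rd iv eD lek.
case/lastP: Stk iv => [|Stk s] iv.
  apply: hrun_while_false => //=; rewrite ?(inv_sp iv) ?addn1 //.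
  by exists D, Pr.
have un := inv_uniq iv; rewrite -rcons_cat rcons_uniq mem_cat negb_or -andbA in un.
case/and3P: un => sPr sStk un.
have ecost : saturate_cost Pr = 6 + 15 * size (occ P s) + saturate_cost (s :: Pr).
  rewrite /saturate_cost (bigD1 s) //=; congr (_ + _); apply: eq_bigl => s'.
  by rewrite inE negb_or andbC.
rewrite ecost in lek.
pose k' := k - (6 + 15 * size (occ P s)).
apply: (hrun_weaken (u := ((3 + (15 * size (occ P s) + 1)) + (k' + 1)).+1)) (fun=> id);
  last by rewrite /k'; move: lek; clear; lia.
apply: hrun_while_true; first by rewrite /= (inv_sp iv) size_rcons.
set st1 := hsem (decr rsp ;; rs <~ HGet 10 (HV rsp) ;; re <~ HGet 1 (HV rs)) st.
have esp : hreg st1 rsp = size Stk by rewrite /= (inv_sp iv) size_rcons subn1.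
have ers : hreg st1 rs = code s.
  rewrite /= (inv_sp iv) size_rcons subn1 (inv_stk iv) ?size_rcons //.
  by rewrite nth_rcons ltnn eqxx.
have ere : hreg st1 re = harr st 1 (code s) by rewrite -ers.
have iv1 : inv st1 D (s :: Pr) Stk.
  have perm : perm_eq (Pr ++ rcons Stk s) ((s :: Pr) ++ Stk).
    by rewrite -cats1 catA perm_catC.
  split.
  - exact: inv_opt iv.
  - exact: inv_state iv.
  - exact: esp.
  - move=> i lti; have := inv_stk iv (i := i); rewrite size_rcons nth_rcons lti.
    by apply; apply: ltnW.
  - by rewrite -(perm_uniq perm) (inv_uniq iv).
  - by move=> q; rewrite -(perm_mem perm) (inv_mem iv).
  - by move=> q; rewrite -(perm_mem perm); apply: (inv_sub iv).
have eD1 x : x \in P -> count_mem x.1 (occ P s ++ D) = count [in s :: Pr] x.2.2.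
  move=> xP; rewrite count_cat (count_occ _ xP) (eD x xP) count_in_cons //.
  exact: uniq_succ.
have rd1 : ready st1 by case: rd => rd0 bl; split=> //; apply: built_weaken bl _ _.
have lC x : x \in P -> count_mem x.1 (occ P s ++ D) <= count [in X] x.2.2.
  move=> xP; rewrite eD1 //; apply: sub_count => q /=; move=> qs.
  by apply: (inv_sub iv1); rewrite mem_cat qs.
apply: hrun_block_seq => //.
apply: hrun_weaken (hrun_frame (@touch_loop_run (occ P s) st1 D (s :: Pr) Stk rd1 _ _ iv1 lC)) (leqnn _) _.
- by rewrite ere; apply: (built_occ rd.2).
- by move=> o /mapP[x]; rewrite mem_filter => /andP[_ xP] ->; apply: map_f.
move=> st2 [[Stk' iv2] fV fA].
apply: (IH k' _ st2 _ (s :: Pr) Stk' _ iv2).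
- by rewrite /k'; move: lek; clear; lia.
- by apply: (ready_frame fV fA _ rd1).
- by move=> x xP; rewrite catrevE -eD1 // !count_cat count_rev.
- by rewrite /k'; move: lek; clear; lia.
Qed.

End Evaluate.

(** * Correctness and cost of a round *)

Section EvaluateRun.
Variables (Q Sigma : finType) (Aut : aapta Q Sigma).
Let inp := code_aapta Aut.
Let om := omega Aut.
Let q0 := init_state Aut.
Notation code := (@code_state Q).
Variable pm : nat.
Variable P : seq (nat * (Q * seq Q)).
Hypotheses (uniqP : uniq (map fst P)) (uniq_succ : forall x, x \in P -> uniq x.2.2)
  (sndP : map snd P = rev (all_options Aut)).
Variable Y : {set Q}.
Hypothesis dY : is_default om (mode_least pm) pm Y.
Notation G := (mode_pre Aut pm).
Let X := approx om G pm Y #|Q|.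
Let mono_G : mono G := mode_pre_mono Aut pm.

Lemma mode_least_max : mode_least pm pm.
Proof. exact: eqxx. Qed.

Lemma limit_closed q : om q = pm -> q \in G X -> q \in X.
Proof. by move=> e h; rewrite /X (approx_fix mono_G dY) approxS. Qed.

Lemma nested_fix_limit : nested_fix om G 1 pm Y = G X.
Proof. by []. Qed.

(** With an empty worklist the processed set [Z] is a fixpoint: at level [pm] it agrees with [G Z],
    elsewhere with [Y]. It contains every stage by induction and lies in the limit [X] by soundness,
    so the two coincide. *)
Lemma inv_final st D Pr : inv Aut pm P Y X st D Pr [::] ->
  (forall x, x \in P -> count_mem x.1 D = count [in Pr] x.2.2) ->
  forall q, (harr st 8 (code q) == 0) = (q \in nested_fix om G 1 pm Y).
Proof.
move=> iv eD; pose Z := [set q in Pr].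
have zero q : (harr st 8 (code q) == 0) = (q \in G Z).
  rewrite (inv_state iv) subn_eq0 (mode_preE pm uniqP sndP); congr (_ <= _).
  apply: eq_in_count => x xP; rewrite /fired /fires (eD x xP); congr (_ && (_ < _ <= _)).
  by apply: eq_count => s; rewrite /= inE.
suff -> : nested_fix om G 1 pm Y = G Z by [].
have memZ q : (q \in Z) = if om q == pm then q \in G Z else q \in Y.
  by rewrite -zero -(inv_mem iv) cats0 inE.
rewrite nested_fix_limit; congr (G _); apply/eqP; rewrite eqEsubset; apply/andP; split; last first.
  by apply/subsetP=> q; rewrite inE => qP; apply: (inv_sub iv); rewrite cats0.
rewrite /X; elim: #|Q| => [|i IH]; last first.
  apply/subsetP=> q; rewrite memZ inE; case: ifP => // _.
  exact: (subsetP (mono_G IH)).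
apply/subsetP=> q /= qY; rewrite memZ; case: eqP => // e.
by rewrite dY ?e ?leqnn // mode_least_max in qY.
Qed.

(** Double counting: the lists of all states together have one entry per edge, and [built_size]
    bounds the edges by the length of the input. *)
Lemma saturate_cost_init st : ready Aut pm P st ->
  saturate_cost P [::] <= 6 * #|Q| + 15 * size inp.
Proof.
case=> _ bl; rewrite /saturate_cost big_split /= sum_nat_const -big_distrr /=.
have -> : #|[pred s : Q | s \notin [::]]| = #|Q| by apply: eq_card => s; rewrite inE.
rewrite mulnC leq_add2l leq_mul2l /=; apply: leq_trans (built_size bl).
have -> : \sum_(s : Q | s \notin [::]) size (occ P s) = \sum_(x <- P) \sum_(s : Q) (s \in x.2.2).
  rewrite exchange_big /=; apply: eq_bigr => s _; rewrite /occ size_map size_filter -sum1_count big_mkcond /=.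
  by apply: eq_bigr => x _; case: (_ \in _).
rewrite big_seq [X in _ <= X]big_seq; apply: leq_sum => x xP.
by rewrite -big_mkcond /= sum1_card (card_uniqP (uniq_succ xP)).
Qed.

Lemma evaluate_run st : ready Aut pm P st -> (forall q, harr st 9 (code q) = (q \in Y)) ->
  hrun evaluate st (20 * (size inp + #|Q|) + 10) (fun st' =>
    forall q, (harr st' 8 (code q) == 0) = (q \in nested_fix om G 1 pm Y)).
Proof.
move=> rd eY; have costS := saturate_cost_init rd.
apply: (hrun_weaken (u := (1 + (size inp * 3 + 1)) + ((2 + (#|Q| * 11 + 1)) +
  (6 * #|Q| + 15 * size inp + 1)))) (fun=> id); last by clear; lia.
apply: hrun_seq; apply: hrun_block_seq => //.
pose I1 i st := [/\ hreg st ri = i, ready Aut pm P st, forall q, harr st 9 (code q) = (q \in Y) &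
  forall j, j < i -> harr st 6 j = harr st 5 j].
apply: hrun_weaken (hrun_for_cst (u := 2) (I := I1) (N := size inp) _ _ _) (leqnn _) _.
- split=> //; case: rd => rd0 bl; split=> //; exact: built_weaken bl _ _.
- by move=> i st' [e [[_ e1 _ _ _] _] _]; split.
- move=> i st' lti [e rd' eY' e6]; apply: hrun_block => //; split.
  + by rewrite /= e addn1.
  + case: rd' => rd0 bl; split=> //; apply: built_weaken bl _ _ => //.
    by move=> [|[|[|[|[|[|[|a]]]]]]].
  + exact: eY'.
  + move=> j; rewrite ltnS => lej; rewrite -[LHS]/(setf (harr st' 6) (hreg st' ri) (harr st' 5 (hreg st' ri)) j) setfE e.
    case: eqVneq => [->//|ne]; apply: e6; by rewrite ltn_neqAle ne.
move=> st1 [_ rd1 eY1 e6].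
apply: hrun_seq; apply: hrun_block_seq => //.
pose I2 i st := [/\ hreg st rq = i, ready Aut pm P st, forall q, harr st 9 (code q) = (q \in Y),
  forall q, code q < i -> harr st 8 (code q) = state_threshold pm P q & 
  [/\ forall j, j < size inp -> harr st 6 j = harr st 5 j & exists Stk, [/\ hreg st rsp = size Stk,
    forall j, j < size Stk -> harr st 10 j = code (nth q0 Stk j), uniq Stk &
    forall q, (q \in Stk) = (code q < i) && (if om q == pm then state_threshold pm P q == 0 else q \in Y)]]].
apply: hrun_weaken (hrun_for_cst (u := 10) (I := I2) (N := #|Q|) _ _ _) (leqnn _) _.
- split=> //; first by case: rd1 => rd0 bl; split=> //; exact: built_weaken bl _ _.
  by split=> //; exists [::].
- by move=> i st' [e [[_ _ e1 _ _] _] _]; split.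
- move=> i st' lti [e rd' eY' e8 [e6' [Stk [esp estk us memS]]]]; apply: hrun_block => //.
  have [q eq] := code_surj lti; set st3 := hsem _ _.
  pose push := if om q == pm then state_threshold pm P q == 0 else q \in Y.
  have [[inpE _ _ epm _] bl] := rd'.
  have eom : harr st' 0 (3 + i) = om q by rewrite inpE -eq nth_omega.
  have es : harr st' 7 i = state_threshold pm P q by rewrite -eq (built_sini bl).
  have eYi : harr st' 9 i = (q \in Y) by rewrite -eq eY'.
  have [h8 h10 hsp hq] : [/\ harr st3 8 = setf (harr st' 8) i (state_threshold pm P q),
      harr st3 10 = if push then setf (harr st' 10) (hreg st' rsp) i else harr st' 10,
      hreg st3 rsp = hreg st' rsp + push & hreg st3 rq = i.+1].
    rewrite /st3 /seed_body /push /= e eom epm es; case: (om q == pm) => /=.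
      by case: (state_threshold pm P q) => [|k] /=; rewrite ?e ?addn1 ?addn0.
    by rewrite e eYi; case: (q \in Y) => /=; rewrite ?e ?addn1 ?addn0.
  have [fV fA] : (forall r, wrV seed r = false -> hreg st3 r = hreg st' r) /\
      (forall a, wrA seed a = false -> harr st3 a = harr st' a).
    have [k _ ex] := hexec_loopfree st' (erefl : loopfree (seed_body ;; incr rq)).
    have [fV fA] := hexec_frame ex; split=> x /negbT/norP[_ /negbTE]; [apply: fV | apply: fA].
  split=> //.
  + exact: (ready_frame fV fA _ rd').
  + by move=> q'; rewrite fA.
  + move=> q'; rewrite ltnS h8 setfE -eq (inj_eq (@code_inj Q)) leq_eqVlt (inj_eq (@code_inj Q)).
    by case: eqVneq => [->|_] //= lt; apply: e8; rewrite -eq.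
  split; first by move=> j ltj; rewrite !fA ?e6'.
  have qS : q \notin Stk by rewrite memS eq ltnn.
  have split_q q' : (code q' < i.+1) = (q' == q) || (code q' < i).
    by rewrite ltnS leq_eqVlt -eq (inj_eq (@code_inj Q)).
  exists (if push then rcons Stk q else Stk); case ep: push h10 hsp => h10 hsp; split=> //.
  + by rewrite size_rcons hsp esp addn1.
  + move=> j; rewrite size_rcons ltnS h10 setfE nth_rcons esp leq_eqVlt => /orP[/eqP->|lt].
      by rewrite !eqxx ltnn.
    by rewrite lt ltn_eqF // estk.
  + by rewrite rcons_uniq qS.
  + move=> q'; by rewrite mem_rcons inE memS split_q; case: (eqVneq q' q) => [->|] //=.
  + by rewrite hsp esp addn0.
  + by move=> j; rewrite h10; apply: estk.
  + move=> q'; rewrite memS split_q; case: (eqVneq q' q) => [->|] //=.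
    by rewrite eq ltnn; exact: esym ep.
move=> st2 [_ rd2 eY2 e8 [e62 [Stk [esp estk us memS]]]].
have iv : inv Aut pm P Y X st2 [::] [::] Stk.
  split=> //.
  - by move=> x xP; rewrite subn0 e62; case: (built_opt rd2.2 xP).
  - move=> q; rewrite e8 ?code_lt // -[LHS]subn0; congr (_ - _).
    rewrite /nfired -(count_pred0 P); apply: eq_count => x /=.
    by rewrite /fired /=; case: (option_threshold pm x.2.2) => [|c]; rewrite andbF.
  - by move=> q; rewrite memS code_lt e8 ?code_lt.
  - move=> q; rewrite memS code_lt /=; case: eqP => [e /eqP s0|/eqP ne qY].
      by apply: limit_closed => //; rewrite (mode_preE pm uniqP sndP) s0.
    by rewrite /X approx_low.
apply: hrun_weaken (saturate_run uniqP uniq_succ sndP (fun q => @limit_closed q) rd2 iv _ costS) _ _ => //.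
  by move=> x xP /=; rewrite (eq_count (a2 := pred0)) ?count_pred0.
by move=> st3 [D' [Pr' [iv' eD']]] q; apply: inv_final iv' eD' q.
Qed.

End EvaluateRun.

(** * The odometer as a program *)

Definition fired_bit r e := HIf (pos (HGet 8 e)) (r <~ HC 0) (r <~ HC 1).

(** [rk] holds the deepest unstable level plus one, so that 0 can mean that every level is
    stable. *)
Definition scan_body : hcmd :=
  rx <~ HGet 0 (HAdd (HC 3) (HV rq)) ;;
  fired_bit ry (HV rq) ;;
  HIf (HLt (HV rx) (HV rpm))
    (HIf (HNe (HV ry) (HGet 9 (HV rq)))
      (HIf (HLt (HV rk) (HAdd (HV rx) (HC 1))) (rk <~ HAdd (HV rx) (HC 1)) skip)
      skip)
    skip.

Definition scan : hcmd := (rk <~ HC 0 ;; rq <~ HC 0) ;; hfor rq rn scan_body.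

Definition update_body : hcmd :=
  rx <~ HGet 0 (HAdd (HC 3) (HV rq)) ;;
  fired_bit ry (HV rq) ;;
  HIf (HNe (HAdd (HV rx) (HC 1)) (HV rk))
    (HIf (HLt (HV rk) (HAdd (HV rx) (HC 1)))
      (HIf (HNe (parity_exp (HV rx)) (HV rbeta)) (HPut 9 (HV rq) (HC 1)) (HPut 9 (HV rq) (HC 0)))
      skip)
    (HPut 9 (HV rq) (HV ry)).

Definition update : hcmd := (rq <~ HC 0) ;; hfor rq rn update_body.

(** The last turn ends with [rk] at 0, and its update resets the whole assignment; the result
    survives in array 8, which neither [scan] nor [update] writes. *)
Definition main_loop := HWhile (pos (HV rk)) (evaluate ;; scan ;; update).

(** A fired initial state is won by the automaton if [rbeta] is 1 and by the opponent if it is 0, so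
    in both modes emptiness means that the two bits differ. *)
Definition answer : hcmd :=
  fired_bit ry (HGet 0 (HC 2)) ;;
  HIf (HNe (HV ry) (HV rbeta)) (0 <~ HC 1) (0 <~ HC 0).

Definition decide : hcmd :=
  max_priority ;; init_arrays ;; build ;; (rk <~ HC 1) ;; main_loop ;; answer.

Section MainLoop.
Variables (Q Sigma : finType) (Aut : aapta Q Sigma).
Let inp := code_aapta Aut.
Let om := omega Aut.
Notation code := (@code_state Q).
Variable pm : nat.
Variable P : seq (nat * (Q * seq Q)).
Hypotheses (uniqP : uniq (map fst P)) (uniq_succ : forall x, x \in P -> uniq x.2.2)
  (sndP : map snd P = rev (all_options Aut)).
Notation G := (mode_pre Aut pm).
Notation E := (nested_fix om G 1 pm).
Notation mu := (mode_least pm).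
Notation ready := (ready Aut pm P).
Implicit Types (Y R : {set Q}).

Lemma scan_run st Y R : ready st -> (forall q, harr st 9 (code q) = (q \in Y)) ->
  (forall q, (harr st 8 (code q) == 0) = (q \in R)) ->
  hrun scan st (10 * #|Q| + 3) (fun st' =>
    (forall q, om q < pm -> (q \in R) != (q \in Y) -> om q < hreg st' rk) /\
    (hreg st' rk = 0 \/ exists q, [/\ (om q).+1 = hreg st' rk, om q < pm & (q \in R) != (q \in Y)])).
Proof.
move=> rd eY eR.
pose I i st := [/\ hreg st rq = i, ready st, 
  (forall q, harr st 9 (code q) = (q \in Y)) /\ (forall q, (harr st 8 (code q) == 0) = (q \in R)),
  forall q, code q < i -> om q < pm -> (q \in R) != (q \in Y) -> om q < hreg st rk &
  hreg st rk = 0 \/ exists q, [/\ (om q).+1 = hreg st rk, om q < pm & (q \in R) != (q \in Y)]].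
apply: (hrun_weaken (u := 2 + (#|Q| * 9 + 1)) (P := I #|Q|)); last 2 first.
- by clear; lia.
- by move=> st' [_ _ _ h1 h2]; split=> // q; apply: h1; apply: code_lt.
apply: hrun_block_seq => //; apply: hrun_for_cst.
- split=> //; last by left.
  by case: rd => rd0 bl; split=> //; apply: built_weaken bl _ _.
- by move=> i st' [e [[_ _ e1 _ _] _] _]; split.
move=> i st' lti [e rd' [eY' eR'] h1 h2]; apply: hrun_block => //.
have [q eq] := code_surj lti; set st3 := hsem _ _.
have [[inpE _ _ epm _] bl] := rd'.
have eom : harr st' 0 (3 + i) = om q by rewrite inpE -eq nth_omega.
have eYi : harr st' 9 i = (q \in Y) by rewrite -eq eY'.
have eRi : (0 < harr st' 8 i) = (q \notin R) by rewrite lt0n -eR' -eq.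
pose better := [&& om q < pm, (q \in R) != (q \in Y) & hreg st' rk < (om q).+1].
have hk : hreg st3 rk = if better then (om q).+1 else hreg st' rk.
  rewrite /st3 /scan_body /fired_bit /better /= e eom eRi.
  case: (q \in R) => /=; rewrite epm; case: (om q < pm) => //=; rewrite e eYi;
    by case: (q \in Y) => //=; rewrite addn1; case: (_ < _).
have [fV fA] : (forall r, wrV scan r = false -> hreg st3 r = hreg st' r) /\
    (forall a, wrA scan a = false -> harr st3 a = harr st' a).
  have [k _ ex] := hexec_loopfree st' (erefl : loopfree (scan_body ;; incr rq)).
  by have [fV fA] := hexec_frame ex; split=> x /negbT/norP[_ /negbTE]; [apply: fV | apply: fA].
have split_q q' : (code q' < i.+1) = (q' == q) || (code q' < i).
  by rewrite ltnS leq_eqVlt -eq (inj_eq (@code_inj Q)).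
split.
- have [k _ ex] := hexec_loopfree st' (erefl : loopfree scan_body).
  by rewrite -[LHS]/(hreg (hsem scan_body st') rq + 1) (hexec_frame ex).1 // e addn1.
- exact: (ready_frame fV fA _ rd').
- by split=> q'; rewrite fA.
- move=> q'; rewrite split_q hk => /orP[/eqP->|lt] ltq' ne.
    by rewrite /better ltq' ne /=; case: (ltnP (hreg st' rk) (om q).+1).
  have := h1 q' lt ltq' ne; case: ifP => // /and3P[_ _ lt2] lt3; exact: ltn_trans lt3 lt2.
- rewrite hk; case: ifP => [/and3P[lt ne _]|_] //.
  by right; exists q.
Qed.

Lemma update_run st Y R : ready st -> (forall q, harr st 9 (code q) = (q \in Y)) ->
  (forall q, (harr st 8 (code q) == 0) = (q \in R)) ->
  hrun update st (10 * #|Q| + 3) (fun st' => forall q, harr st' 9 (code q) =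
    if (om q).+1 == hreg st rk then q \in R else
    if (om q).+1 < hreg st rk then q \in Y else ~~ mu (om q)).
Proof.
move=> rd eY eR.
pose bit q := if (om q).+1 == hreg st rk then q \in R else
    if (om q).+1 < hreg st rk then q \in Y else ~~ mu (om q).
pose I i st' := [/\ hreg st' rq = i, ready st', hreg st' rk = hreg st rk,
  (forall q, (harr st' 8 (code q) == 0) = (q \in R)) &
  forall q, harr st' 9 (code q) = if code q < i then bit q else q \in Y].
apply: (hrun_weaken (u := 1 + (#|Q| * 9 + 1)) (P := I #|Q|)); last 2 first.
- by clear; lia.
- by move=> st' [_ _ _ _ h] q; rewrite h code_lt.
apply: hrun_block_seq => //; apply: hrun_for_cst.
- split=> //; by case: rd => rd0 bl; split=> //; apply: built_weaken bl _ _.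
- by move=> i st' [e [[_ _ e1 _ _] _] _]; split.
move=> i st' lti [e rd' ek eR' eY']; apply: hrun_block => //.
have [q eq] := code_surj lti; set st3 := hsem _ _.
have [[inpE _ _ epm eb] bl] := rd'.
have eom : harr st' 0 (3 + i) = om q by rewrite inpE -eq nth_omega.
have eYi : harr st' 9 i = (q \in Y) by rewrite -eq eY' eq ltnn.
have eRi : (0 < harr st' 8 i) = (q \notin R) by rewrite lt0n -eR' -eq.
have h9 j : harr st3 9 j = if j == i then nat_of_bool (bit q) else harr st' 9 j.
  rewrite /st3 /update_body /fired_bit /bit /= e eom eRi.
  have push k : setf (harr st' 9) i k j = if j == i then k else harr st' 9 j by apply: setfE.
  have neb : (odd (om q) != odd pm :> nat) = ~~ mu (om q).
    by rewrite /mode_least; case: (odd _) (odd _) => [] [].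
  have skipped : harr st' 9 j = if j == i then nat_of_bool (q \in Y) else harr st' 9 j.
    by case: eqP => // ->.
  case: (q \in R) => /=; rewrite ek addn1 eb half_parity neb;
  case: (ltngtP (om q).+1 (hreg st rk)) => /= _; rewrite ?e ?push //;
  by case: (mu _); rewrite /= ?e ?push.
have [fV fA] : (forall r, wrV update r = false -> hreg st3 r = hreg st' r) /\
    (forall a, wrA update a = false -> harr st3 a = harr st' a).
  have [k _ ex] := hexec_loopfree st' (erefl : loopfree (update_body ;; incr rq)).
  by have [fV fA] := hexec_frame ex; split=> x /negbT/norP[_ /negbTE]; [apply: fV | apply: fA].
have split_q q' : (code q' < i.+1) = (q' == q) || (code q' < i).
  by rewrite ltnS leq_eqVlt -eq (inj_eq (@code_inj Q)).
split.
- have [k _ ex] := hexec_loopfree st' (erefl : loopfree update_body).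
  by rewrite -[LHS]/(hreg (hsem update_body st') rq + 1) (hexec_frame ex).1 // e addn1.
- exact: (ready_frame fV fA _ rd').
- by rewrite fV.
- by move=> q'; rewrite fA.
- move=> q'; rewrite h9 split_q -eq (inj_eq (@code_inj Q)); case: eqVneq => [->|] //= _.
  by rewrite eq eY'.
Qed.

Definition round_cost := 20 * size inp + 40 * #|Q| + 20.

Lemma is_default_reset_above k Y : k < pm -> is_default om mu pm (reset_above om E mu k Y).
Proof.
move=> ltk q le; rewrite inE ifN ?ifN //.
  by rewrite -leqNgt (leq_trans (ltnW ltk)).
by rewrite neq_ltn (leq_trans ltk) ?orbT.
Qed.

(** One turn per step of the odometer, and one more that finds no unstable level. Each turn starts
    with level [pm] at its default, as [evaluate_run] requires, because a reset extends up to that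
    level. *)
Lemma main_loop_run t Y Z st : reach om E mu pm t Y Z -> stable om E pm 0 Z ->
  is_default om mu pm Y -> ready st -> (forall q, harr st 9 (code q) = (q \in Y)) -> 0 < hreg st rk ->
  hrun main_loop st (t.+1 * round_cost.+1 + 1) (fun st' =>
    ready st' /\ forall q, (harr st' 8 (code q) == 0) = (q \in E Z)).
Proof.
move=> rYZ stZ; elim: rYZ st stZ => {t Y Z} [Z|k t Y Z ltk [q1 eq1 un] stY rYZ IH] st stZ dY rd eY k0.
  rewrite mul1n addSn; apply: hrun_while_true => //.
  apply: (hrun_weaken (u := (20 * (size inp + #|Q|) + 10) + ((10 * #|Q| + 3) + (10 * #|Q| + 3)))) (fun=> id);
    last by rewrite /round_cost; clear; lia.
  apply: hrun_seq; apply: hrun_weaken (hrun_frame (evaluate_run uniqP uniq_succ sndP dY rd eY)) (leqnn _) _.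
  move=> st1 [eR fV fA]; have rd1 := ready_frame fV fA isT rd.
  have eY1 q : harr st1 9 (code q) = (q \in Z) by rewrite fA.
  apply: hrun_seq; apply: hrun_weaken (hrun_frame (scan_run rd1 eY1 eR)) (leqnn _) _.
  move=> st2 [[_ ek] fV2 fA2]; have rd2 := ready_frame fV2 fA2 isT rd1.
  have eY2 q : harr st2 9 (code q) = (q \in Z) by rewrite fA2.
  have eR2 q : (harr st2 8 (code q) == 0) = (q \in E Z) by rewrite fA2.
  apply: hrun_weaken (hrun_frame (update_run rd2 eY2 eR2)) (leqnn _) _.
  move=> st3 [_ fV3 fA3]; have rd3 := ready_frame fV3 fA3 isT rd2.
  apply: hrun_while_false => //=.
    rewrite fV3 // -leqNgt leqn0; case: ek => [->//|[q [_ lt ne]]].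
    by rewrite (stZ q) ?eqxx in ne.
  by split=> // q; rewrite fA3.
rewrite mulSn -addnA addSn; apply: hrun_while_true => //.
apply: (hrun_weaken (u := (20 * (size inp + #|Q|) + 10) + ((10 * #|Q| + 3) + (10 * #|Q| + 3)))) (fun=> id);
  last by rewrite /round_cost; clear; lia.
apply: hrun_seq; apply: hrun_weaken (hrun_frame (evaluate_run uniqP uniq_succ sndP dY rd eY)) (leqnn _) _.
move=> st1 [eR fV fA]; have rd1 := ready_frame fV fA isT rd.
have eY1 q : harr st1 9 (code q) = (q \in Y) by rewrite fA.
apply: hrun_seq; apply: hrun_weaken (hrun_frame (scan_run rd1 eY1 eR)) (leqnn _) _.
move=> st2 [[ub ek] fV2 fA2]; have rd2 := ready_frame fV2 fA2 isT rd1.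
have eY2 q : harr st2 9 (code q) = (q \in Y) by rewrite fA2.
have eR2 q : (harr st2 8 (code q) == 0) = (q \in E Y) by rewrite fA2.
(* Instability at level [k] gives one inequality, stability above it the other: the program makes
   the very step of [reach]. *)
have ekk : hreg st2 rk = k.+1.
  have := ub q1; rewrite eq1 => /(_ ltk un); case: ek => [->//|[q [<- ltq ne]]].
  rewrite ltnS => le; congr _.+1; apply/eqP; rewrite eqn_leq le andbT leqNgt.
  by apply/negP=> lt; rewrite (stY q) ?eqxx in ne.
apply: hrun_weaken (hrun_frame (update_run rd2 eY2 eR2)) (leqnn _) _.
move=> st3 [e9 fV3 fA3]; have rd3 := ready_frame fV3 fA3 isT rd2.
apply: IH => //; first exact: is_default_reset_above.
  by move=> q; rewrite e9 ekk eqSS ltnS inE; case: eqP => // _; case: ifP.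
by rewrite fV3 // ekk.
Qed.

End MainLoop.

(** * The whole decision procedure *)

Section Decide.
Variables (Q Sigma : finType) (Aut : aapta Q Sigma).
Hypothesis nonalt : nonalternating Aut.
Let inp := code_aapta Aut.
Let om := omega Aut.
Let q0 := init_state Aut.
Notation code := (@code_state Q).

(** An empty class contributes a factor 1, so only the occurring priorities below [pm] count. A
    nonempty one misses the state [qm] of priority [pm], which makes room for the successor in its
    factor. *)
Lemma prod_nclass pm : (forall q, om q <= pm) -> (exists q, om q = pm) ->
  \prod_(0 <= p < pm) (nclass om p).+1 <= #|Q| ^ (num_priorities Aut).-1.
Proof.
move=> le_pm [qm eqm].
have n0 : 0 < #|Q| by apply/card_gt0P; exists qm.
pose s := [seq p <- iota 0 pm | p \in codom om].
apply: (@leq_trans (#|Q| ^ size s)); last first.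
  have d0 : 0 < num_priorities Aut.
    rewrite /num_priorities -/om; case e: (undup _) => //.
    by have := codom_f om qm; rewrite -mem_undup e.
  rewrite leq_pexp2l // -ltnS prednK //.
  apply: (@uniq_leq_size _ (pm :: s)).
    by rewrite /= filter_uniq ?iota_uniq // mem_filter mem_iota add0n ltnn !andbF.
  move=> p; rewrite inE mem_filter mem_undup => /orP[/eqP->|/andP[//]].
  by rewrite -eqm codom_f.
rewrite /index_iota subn0 size_filter.
have : {in iota 0 pm, forall p, p < pm} by move=> p; rewrite mem_iota.
elim: (iota 0 pm) => [|p l IH] hl; first by rewrite big_nil.
rewrite big_cons /= expnD leq_mul //; last by apply: IH => p' pl; apply: hl; rewrite inE pl orbT.
have ltp := hl p (mem_head _ _); case pc: (p \in codom om).
  rewrite expn1 -cardsT; apply: proper_card; apply/properP; split; first exact: subsetT.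
  by exists qm; rewrite ?inE // eqm gtn_eqF.
rewrite expn0 /nclass eq_card0 // => q; rewrite inE; apply/eqP => e.
by move/negP: pc; apply; rewrite -e codom_f.
Qed.

Definition initial_bits pm : {set Q} := [set q | ~~ mode_least pm (om q)].

(** By [nested_fix_last] the two nested fixpoints merge into one over all levels. If [pm] is even it
    describes the side of the opponent, and complementing it returns to the side of the
    automaton. *)
Lemma initial_bits_winning pm : (forall q, om q <= pm) ->
  (q0 \in nested_fix om (nested_fix om (mode_pre Aut pm) 1 pm) pm 0 (initial_bits pm)) != odd pm <->
  language_empty Aut.
Proof.
move=> le_pm; rewrite -[X in nested_fix om X pm]/(nested_fix om _ 1 (0 + pm)) -nested_fix_last.
have lt q : om q < pm.+1 by rewrite ltnS.
case e: (odd pm).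
  have -> : mode_pre Aut pm = cpre Aut by rewrite /mode_pre e.
  have d : is_default om odd 0 (initial_bits pm) by move=> q _; rewrite inE /mode_least e eqb_id.
  have [h1 h2] := winning_region nonalt lt d; split.
    by move=> nw; apply: NNPP => ne; move: nw; rewrite (h2 ne).
  by move=> em; apply/negP => /eqP/h1; apply.
have -> : mode_pre Aut pm = dual (cpre Aut) by rewrite /mode_pre e.
have d : is_default om odd 0 (~: initial_bits pm).
  by move=> q _; rewrite !inE /mode_least e eqbF_neg negbK.
have [h1 h2] := winning_region nonalt lt d.
rewrite -[initial_bits pm]setCK nested_fix_dual inE; split.
  by move=> nw; apply: NNPP => /h2 w; move: nw; rewrite -/om -/q0 w.
by move=> em; rewrite eqbF_neg negbK; apply/negP => /h1; apply.
Qed.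

Lemma decide_run st : static Aut st -> (forall a q, 0 < a -> harr st a (code q) = 0) ->
  hrun decide st (100 * (size inp + #|Q|) * #|Q| ^ (num_priorities Aut).-1)
    (fun st' => exists b : bool, hreg st' 0 = b /\ (b <-> language_empty Aut)).
Proof.
move=> sst hA0; have [_ eL en es] := sst; set d := _.-1.
have n0 : 0 < #|Q| by apply/card_gt0P; exists q0.
have L3 : 3 <= size inp by rewrite size_inp; clear; lia.
pose T := #|Q| ^ d; have T0 : 0 < T by rewrite expn_gt0 n0.
apply: (hrun_weaken (u := (10 * #|Q| + 3) + ((10 * #|Q| + 3) + ((30 * size inp + 10 * #|Q|) +
    (1 + ((T * (round_cost Aut).+1 + 1) + 10)))))) (fun=> id); last first.
  (* The costs incurred once are absorbed because [T] is at least 1. *)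
  rewrite -/T /round_cost -/inp; have := leq_pmull (30 * size inp + 30 * #|Q| + 18) T0.
  move: (T) (#|Q|) (size inp) n0 L3 => t n L n0 L3 h.
  apply: (@leq_trans (t * (30 * L + 30 * n + 18) + t * (20 * L + 40 * n + 21))).
    by apply: leq_trans (leq_add h (leqnn _)); rewrite -[_.+1]addn1 -!addnA; lia.
  by rewrite -mulnDr [X in _ <= X]mulnC leq_mul2l; lia.
apply: hrun_seq; apply: hrun_weaken (hrun_frame (max_priority_run sst)) (leqnn _) _.
move=> st1 [[ub1 ex1] fV1 fA1]; move epm: (hreg st1 rpm) => pm in ub1 ex1.
have sst1 : static Aut st1 by case: sst => i0 i1 i2 i3; split; rewrite ?fV1 ?fA1.
apply: hrun_seq; apply: hrun_weaken (hrun_frame (init_arrays_run sst1 epm)) (leqnn _) _.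
move=> st2 [[eb e7 e9] fV2 fA2].
have sst2 : static Aut st2 by case: sst1 => i0 i1 i2 i3; split; rewrite ?fV2 ?fA2.
have e1 q : harr st2 1 (code q) = 0 by rewrite fA2 // fA1 // hA0.
apply: hrun_seq; apply: hrun_weaken (hrun_frame (build_run nonalt sst2 eb e1 e7)) (leqnn _) _.
move=> st3 [[P [bl sndP]] fV3 fA3].
have sst3 : static Aut st3 by case: sst2 => i0 i1 i2 i3; split; rewrite ?fV3 ?fA3.
apply: hrun_block_seq => //; set st4 := hsem _ _.
have uniqP := built_uniq bl.
have uniq_succ x : x \in P -> uniq x.2.2 by case/(built_opt bl).
have rd : ready Aut pm P st4.
  case: sst3 => i0 i1 i2 i3; split; last by apply: built_weaken bl _ _.
  by split=> //=; rewrite fV3 // fV2.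
pose Y := initial_bits pm.
have dY : is_default om (mode_least pm) 0 Y by move=> q _; rewrite inE.
have eY q : harr st4 9 (code q) = (q \in Y) by rewrite /= fA3 // e9 inE.
have [t [Z [rYZ ltt stZ _ eZ]]] :=
  reach_fixpoint (nested_fix_mono om 1 pm (@mode_pre_mono _ _ Aut pm)) (add0n pm) dY.
apply: hrun_seq.
apply: hrun_weaken (main_loop_run uniqP uniq_succ sndP rYZ stZ (is_defaultW (leq0n pm) dY) rd eY _) _ _ => //.
  rewrite leq_add2r leq_mul2r; apply/orP; right.
  exact: leq_trans ltt (prod_nclass ub1 ex1).
move=> st5 [rd5 e8]; apply: hrun_block => //.
have [[inpE _ _ _ eb5] _] := rd5.
have e0 : harr st5 0 2 = code q0 by rewrite inpE.
exists ((q0 \in nested_fix om (nested_fix om (mode_pre Aut pm) 1 pm) pm 0 Y) != odd pm).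
split; last exact: initial_bits_winning.
rewrite -eZ -e8 /= e0; case: posnP => e8q /=; rewrite eb5 ?e8q; by case: (odd pm).
Qed.

End Decide.

(** * Assembling the machine program *)

Definition copy_input : cmd :=
  While (Defs.Sub (Reg 1) (Reg 18))
    (Defs.Seq (Store (arr_addr 0 (Reg 18)) (Fetch (Reg 18)))
      (Assign 18 (Defs.Add (Reg 18) (Const 1)))).

Definition copied (inp : seq nat) (i : nat) (s : ram_state) :=
  [/\ regs s 1 = size inp, regs s 18 = i,
    forall j, j < size inp -> Defs.mem s j = nth 0 inp j,
    forall j, Defs.mem s (size inp + 16 * j) = if j < i then nth 0 inp j else 0 &
    forall a j, 0 < a < 16 -> Defs.mem s (size inp + a + 16 * j) = 0].

(** The loop reads in the raw layout and writes in the interleaved one, hence is machine code. All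
    its writes go to addresses from [size inp] on, so no input word is lost before it is read. *)
Lemma copy_input_run inp s m i : m + i = size inp -> copied inp i s ->
  exists k s', [/\ exec copy_input s k s', k <= 46 * m + 4, copied inp (size inp) s' &
    forall r, r != 18 -> regs s' r = regs s r].
Proof.
elim: m i s => [|m IH] i s ei cs; have [e1 e18 lo hi0 hi] := cs.
  exists 4, s; split=> //; last by rewrite -ei.
  by apply: (ExecWhileFalse (e := Defs.Sub (Reg 1) (Reg 18))); rewrite /= e1 e18 -ei subnn.
set s1 := RamState (regs s) (upd (Defs.mem s) (eval s (arr_addr 0 (Reg 18))) (eval s (Fetch (Reg 18)))).
set s2 := RamState (upd (regs s1) 18 (eval s1 (Defs.Add (Reg 18) (Const 1)))) (Defs.mem s1).
have lti : i < size inp by lia.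
have m2 j : Defs.mem s2 j = if j == size inp + 16 * i then nth 0 inp i else Defs.mem s j.
  rewrite -[LHS]/(upd (Defs.mem s) (eval s (arr_addr 0 (Reg 18))) (Defs.mem s (regs s 18)) j).
  have -> : eval s (arr_addr 0 (Reg 18)) = size inp + 16 * i by rewrite /= e1 e18; lia.
  by rewrite /upd e18 lo.
have c2 : copied inp i.+1 s2.
  split.
  - by [].
  - by rewrite /= /upd /= e18 addn1.
  - by move=> j ltj; rewrite m2 ifN ?lo //; apply/eqP; lia.
  - move=> j; rewrite m2 hi0 ltnS; case: (ltngtP j i) => [lt|gt|->]; last by rewrite eqxx.
      by rewrite ifN //; apply/eqP; lia.
    by rewrite ifN //; apply/eqP; lia.
  - by move=> a j lta; rewrite m2 ifN ?hi //; apply/eqP; lia.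
have [k [s' [ex le cs' rr]]] := IH i.+1 s2 (etrans (addnS _ _) (esym (etrans (esym ei) (addSn _ _)))) c2.
(* The test costs 4, the store 38 and the increment 4. The address alone costs 35, as each of the
   four doublings repeats its argument. *)
exists (1 + 3 + (38 + 4) + k), s'; split=> //.
- apply: (ExecWhileTrue (s2 := s2)) ex; first by rewrite /= e1 e18 subn_eq0 -ltnNge.
  apply: (ExecSeq (s2 := s1) (n1 := 38) (n2 := 4)); first exact: ExecStore.
  exact: ExecAssign.
- by rewrite mulnS; lia.
- by move=> r nr; rewrite rr //= /upd (negbTE nr).
Qed.

Section Complexity.
Variables (Q Sigma : finType) (Aut : aapta Q Sigma).

Lemma size_codes_leq m (phis : seq (eu_constr Q)) :
  all (fun phi => eu_size phi <= m) phis -> size (codes phis) <= size phis * (3 * m).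
Proof.
elim: phis => //= phi phis IH /andP[le /IH{}IH].
rewrite /codes /= size_cat mulSn leq_add //.
by apply: leq_trans (size_code_constr phi) _; rewrite leq_mul2l le orbT.
Qed.

(** A formula takes at most three words per unit of size, since an element of supp(E) is written
    with its multiplicity. The header of 3 words and twice [#|Q|] fit into [5 * #|Q|]. *)
Lemma size_code_aapta :
  size (code_aapta Aut) + #|Q| <= 5 * (#|Q| * (1 + delta_size Aut * #|Sigma|)).
Proof.
have n0 : 0 < #|Q| by apply/card_gt0P; exists (init_state Aut).
have h : size (codes (formulas Aut)) <= #|Q| * #|Sigma| * (3 * delta_size Aut).
  have := @size_codes_leq (delta_size Aut) (formulas Aut).
  rewrite size_allpairs -!cardE; apply; apply/all_allpairsP => q sigma _ _.
  by rewrite /delta_size (bigmax_sup q) // (bigmax_sup sigma).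
rewrite size_inp; move: h; rewrite mulnDr muln1 [delta_size _ * _]mulnC.
rewrite [3 * _]mulnC !mulnA; move: (_ * delta_size _) (size _) n0 => x y; lia.
Qed.

End Complexity.

Definition emptiness_program : cmd :=
  Defs.Seq (compile raw_addr measure_input) (Defs.Seq copy_input (compile arr_addr decide)).

(** The factor 5 comes from [size_code_aapta]; 10 and 100 are the unit bounds of the two compiled
    programs, and 50 covers the 46 steps per word and 4 more of the copying loop. *)
Definition emptiness_constant : nat :=
  5 * (step_cost raw_addr measure_input * 10 + 50 + step_cost arr_addr decide * 100).

(** One factor [N] pays for the linear work of a round, and [#|Q| <= N] bounds the number of rounds
    by [N ^ d], where [d] is one less than the number of priorities. *)
Lemma emptiness_program_correct (Q Sigma : finType) (Aut : aapta Q Sigma) :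
  nonalternating Aut ->
  ram_answers_within emptiness_program (code_aapta Aut)
    (emptiness_constant * (#|Q| * (1 + delta_size Aut * #|Sigma|)) ^ num_priorities Aut)
    (language_empty Aut).
Proof.
move=> nonalt; set inp := code_aapta Aut; set N := #|Q| * _.
have [k1 [s1 [st1 [ex1 le1 [rV1 rM1] [[e1 e2 e3 e18] inpE]]]]] :
  exists k s' st', [/\ exec (compile raw_addr measure_input) (ram_init inp) k s',
    k <= step_cost raw_addr measure_input * (10 * (#|Q| + size inp)), raw_rep st' s' &
    [/\ hreg st' 1 = size inp, hreg st' 2 = #|Q|, hreg st' 3 = #|Sigma| & hreg st' 18 = 0] /\
      harr st' 0 =1 nth 0 inp].
  pose st0 := HSt (fun=> 0) (fun a i => nth 0 inp i).
  have run := hrun_frame (measure_input_run nonalt (st := st0) (fun=> erefl)).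
  have rep0 : raw_rep st0 (ram_init inp) by [].
  have [k [s' [st' [ex le rep [h _ fA]]]]] := raw_run run rep0 isT.
  by exists k, s', st'; split=> //; split=> // i; rewrite fA.
have c1 : copied inp 0 s1.
  split=> [||j _|j|a j _]; rewrite ?rV1 // rM1 inpE // nth_default // -?addnA leq_addr //.
have [k2 [s2 [ex2 le2 [m1 m18 mlo mhi0 mhi] r2]]] := copy_input_run (addn0 _) c1.
(* Arrays from 16 on have no place in memory; the value 0 meets the assumption of [decide_run] on
   them. *)
pose st2 := HSt (regs s2) (fun a i => if a < 16 then Defs.mem s2 (size inp + a + 16 * i) else 0).
have rep2 : arr_rep st2 s2 by split=> // a i lta; rewrite /= lta m1.
have static2 : static Aut st2.
  split; rewrite /= ?r2 ?rV1 // => i; rewrite addn0 mhi0 -/inp.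
  by case: ltnP => // le; rewrite nth_default.
have zero2 a (q : Q) : 0 < a -> harr st2 a (code_state q) = 0.
  by move=> a0 /=; case: ifP => // lta; rewrite mhi // a0.
have [k3 [s3 [st3 [ex3 le3 [rV3 _] [b [eb bP]]]]]] :=
  arr_run (decide_run nonalt static2 zero2) rep2 isT.
exists b, (k1 + (k2 + k3)), s3; split=> //; last by rewrite rV3.
  by apply: ExecSeq ex1 _; apply: ExecSeq ex2 ex3.
have n0 : 0 < #|Q| by apply/card_gt0P; exists (init_state Aut).
have d0 : 0 < num_priorities Aut.
  rewrite /num_priorities; case e: (undup _) => //.
  by have := codom_f (omega Aut) (init_state Aut); rewrite -mem_undup e.
have leN : #|Q| <= N by rewrite leq_pmulr.
have leL : size inp + #|Q| <= 5 * N := size_code_aapta Aut.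
set d := (num_priorities Aut).-1 in le3.
have Nd : N ^ num_priorities Aut = N * N ^ d by rewrite -expnS prednK.
have pow : #|Q| ^ d <= N ^ d by case: (d) => // d'; rewrite leq_exp2r.
have one : 0 < N ^ d by rewrite expn_gt0 (leq_trans n0).
rewrite Nd /emptiness_constant.
move: (step_cost raw_addr _) (step_cost arr_addr _) le1 le3 => x y le1 le3.
move: (size inp) (#|Q| ^ d) (N ^ d) pow one leL le1 le2 le3 => L p r pow one leL le1 le2 le3.
have h1 : x * (10 * (#|Q| + L)) <= 5 * (x * 10) * (N * r).
  rewrite addnC; apply: (@leq_trans (x * (10 * (5 * N)))); first by rewrite !leq_mul2l leL !orbT.
  by apply: leq_trans (leq_pmulr _ one) _; rewrite -!mulnA; lia.
have h2 : 46 * L + 4 <= 5 * 50 * (N * r).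
  by have := leq_pmulr N one; move: (N * r); lia.
have h3 : y * (100 * (L + #|Q|) * p) <= 5 * (y * 100) * (N * r).
  apply: (@leq_trans (y * (100 * (5 * N) * r))).
    by rewrite leq_mul2l; apply/orP; right; apply: leq_mul => //; rewrite leq_mul2l leL.
  by rewrite -!mulnA; lia.
move: (N * r) h1 h2 h3 => M h1 h2 h3.
rewrite (_ : 5 * _ * M = 5 * (x * 10) * M + (5 * 50 * M + 5 * (y * 100) * M)); last first.
  by rewrite -!mulnDl -!mulnDr addnA.
exact: leq_add (leq_trans le1 h1) (leq_add (leq_trans le2 h2) (leq_trans le3 h3)).
Qed.

Theorem theorem6 :
  exists (c : cmd) (C : nat),
    forall (Q Sigma : finType) (A : aapta Q Sigma),
      nonalternating A ->
      ram_answers_within c (code_aapta A)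
        (C * (#|Q| * (1 + delta_size A * #|Sigma|)) ^ num_priorities A)
        (language_empty A).
Proof.
exists emptiness_program, emptiness_constant => Q Sigma A.
exact: emptiness_program_correct.
Qed.
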